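(* Let $F(\mathbf u)=\sum_{i=1}^m g_i(\langle \mathbf u,\mathbf e_i\rangle)$ be an odeco function with gradient iteration map $G:S^{d-1}\to S^{d-1}$. Then the hidden basis elements $[\mathbf e_1],\dots,[\mathbf e_m]$ are attractors of the dynamical system $G/{\sim}$ on $S^{d-1}/{\sim}$. Further, there is a set $\mathcal X\subset S^{d-1}$ of full (surface) measure such that for every $\mathbf u(0)\in\mathcal X$, the sequence defined by $\mathbf u(n)=G(\mathbf u(n-1))$ for $n\ge1$ satisfies $[\mathbf u(n)]\to[\mathbf e_i]$ as $n\to\infty$ for some $i\in\{1,\dots,m\}$.
   Context: Let $d\ge 2$, $1\le m\le d$, and let $\mathbf e_1,\dots,\mathbf e_m$ be orthonormal vectors in $\mathbb R^d$, completed arbitrarily to an orthonormal basis $\mathbf e_1,\dots,\mathbf e_d$; write $u_i=\langle\mathbf u,\mathbf e_i\rangle$. An odeco function is a function $F:\overline{B(0,1)}\to\mathbb R$, $F(\mathbf u)=\sum_{i=1}^m g_i(u_i)$, where each $g_i\in C^2([-1,1])$ is real valued and satisfies: (1) $g_i$ is either even or odd; (2) either $\frac{d^2}{dx^2}g_i(\sqrt x)>0$ on $(0,1]$, or $-\frac{d^2}{dx^2}g_i(\sqrt x)>0$ on $(0,1]$; (3) $\frac{d}{dx}g_i(\sqrt x)|_{x=0^+}=0$; (4) $g_i(0)=0$. The gradient iteration map is $G(\mathbf u)=\nabla F(\mathbf u)/\|\nabla F(\mathbf u)\|$ if $\nabla F(\mathbf u)\ne\mathbf 0$, and $G(\mathbf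 u)=\mathbf u$ if $\nabla F(\mathbf u)=\mathbf 0$. On $S^{d-1}$ define $\mathbf u\sim\mathbf v$ iff $|u_i|=|v_i|$ for all $i\in\{1,\dots,d\}$; $[\mathbf u]$ denotes the class of $\mathbf u$. With $\phi([\mathbf u])=\sum_{i=1}^d|u_i|\mathbf e_i$, the quotient $S^{d-1}/{\sim}$ is a metric space under $\mu([\mathbf u],[\mathbf v])=\|\phi([\mathbf u])-\phi([\mathbf v])\|$. Since $\mathbf u\sim\mathbf v$ implies $G(\mathbf u)\sim G(\mathbf v)$, $G$ induces a map $G/{\sim}$ on $S^{d-1}/{\sim}$. A fixed point $[\mathbf v]$ of $G/{\sim}$ is an attractor if it is Lyapunov stable (every neighborhood $N$ of $[\mathbf v]$ contains a neighborhood $N'$ of $[\mathbf v]$ such that orbits starting in $N'$ remain in $N$) and there is a neighborhood of $[\mathbf v]$ such that all orbits starting in it converge to $[\mathbf v]$. *)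

(* Defs.v *)
From HB Require Import structures.
From mathcomp Require Import all_boot all_order all_algebra.
From mathcomp Require Import all_classical all_reals all_analysis.
From mathcomp Require Import ring.

Set Implicit Arguments.
Unset Strict Implicit.
Unset Printing Implicit Defensive.

Import Order.TTheory GRing.Theory Num.Theory.
Import numFieldNormedType.Exports.

Local Open Scope classical_set_scope.
Local Open Scope ring_scope.

(* The library norm on ['rV[R]_d] is the sup norm; [enorm] is the Euclidean
   one.  Both induce the library topology of ['rV[R]_d]. *)
Section Euclid.
Context {R : realType} {d : nat}.
Implicit Types u v w : 'rV[R]_d.

Definition dot u v : R := \sum_(i < d) u 0 i * v 0 i.
Definition enorm u : R := Num.sqrt (dot u u).

Lemma dotC u v : dot u v = dot v u.
Proof. by apply: eq_bigr => i _; rewrite mulrC. Qed.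

Lemma dotDl u v w : dot (u + v) w = dot u w + dot v w.
Proof. by rewrite -big_split; apply: eq_bigr => i _; rewrite mxE mulrDl. Qed.

Lemma dotZl a u v : dot (a *: u) v = a * dot u v.
Proof. by rewrite mulr_sumr; apply: eq_bigr => i _; rewrite mxE mulrA. Qed.

Lemma dotDr u v w : dot w (u + v) = dot w u + dot w v.
Proof. by rewrite dotC dotDl !(dotC w). Qed.

Lemma dotZr a u v : dot u (a *: v) = a * dot u v.
Proof. by rewrite dotC dotZl dotC. Qed.

Lemma dot0l v : dot 0 v = 0.
Proof. by rewrite /dot big1 // => i _; rewrite mxE mul0r. Qed.

Lemma dot_suml (I : finType) (f : I -> 'rV[R]_d) v :
  dot (\sum_i f i) v = \sum_i dot (f i) v.
Proof.
exact: (big_morph (dot^~ v) (fun x y => dotDl x y v) (dot0l v)).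
Qed.

Lemma dot_ge0 u : 0 <= dot u u.
Proof. by apply: sumr_ge0 => i _; rewrite -expr2 sqr_ge0. Qed.

Lemma dot_eq0 u : (dot u u == 0) = (u == 0).
Proof.
apply/eqP/eqP => [u0|->]; last exact: dot0l.
apply/rowP => i; rewrite mxE; apply/eqP; rewrite -sqrf_eq0; apply/eqP.
by apply: (psumr_eq0P _ u0) => // j _; rewrite -expr2 sqr_ge0.
Qed.

Lemma enorm_ge0 u : 0 <= enorm u.
Proof. exact: sqrtr_ge0. Qed.

Lemma enorm_sqr u : enorm u ^+ 2 = dot u u.
Proof. by rewrite sqr_sqrtr // dot_ge0. Qed.

Lemma enorm_eq0 u : (enorm u == 0) = (u == 0).
Proof. by rewrite -sqrf_eq0 enorm_sqr dot_eq0. Qed.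

Lemma enormZ a u : enorm (a *: u) = `|a| * enorm u.
Proof. by rewrite /enorm dotZl dotZr mulrA -expr2 sqrtrM ?sqr_ge0 // sqrtr_sqr. Qed.

Lemma cauchy_schwarz u v : dot u v <= enorm u * enorm v.
Proof.
have [->|v0] := eqVneq v 0.
  by rewrite dotC dot0l mulr_ge0 ?enorm_ge0.
have s0 : 0 < dot v v by rewrite lt_neqAle eq_sym dot_eq0 v0 dot_ge0.
rewrite -sqrtrM ?dot_ge0 //; apply: (le_trans (ler_norm _)).
rewrite -sqrtr_sqr ler_wsqrtr //.
have := dot_ge0 (dot v v *: u + (- dot u v) *: v).
rewrite dotDl !dotDr !dotZl !dotZr (dotC v u).
rewrite [leRHS](_ : _ = dot v v * (dot u u * dot v v - dot u v ^+ 2)).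
  by rewrite pmulr_rge0 // subr_ge0.
by ring.
Qed.

Lemma enormD u v : enorm (u + v) <= enorm u + enorm v.
Proof.
rewrite -(@ler_pXn2r _ 2) ?nnegrE ?addr_ge0 ?enorm_ge0 //.
rewrite sqrrD !enorm_sqr dotDl !dotDr (dotC v u) mulr2n !addrA lerD2r.
by rewrite -!addrA !lerD2l lerD // cauchy_schwarz.
Qed.

Lemma enormB u v : enorm (u - v) = enorm (v - u).
Proof. by rewrite -opprB -scaleN1r enormZ normrN1 mul1r. Qed.

End Euclid.

Section Sphere.
Variables (R : realType) (d : nat).

Record sphere := Sphere {
  sphere_val :> 'rV[R]_d ;
  enorm_sphere : enorm sphere_val == 1 }.

HB.instance Definition _ := [isSub for sphere_val].
HB.instance Definition _ := [Choice of sphere by <:].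

Definition sphere_dist (u v : sphere) : R := enorm (sphere_val u - sphere_val v).

Lemma sphere_distxx u : sphere_dist u u = 0.
Proof. by apply/eqP; rewrite /sphere_dist subrr enorm_eq0. Qed.

Lemma sphere_dist_positivity u v : sphere_dist u v = 0 -> u = v.
Proof.
by move=> /eqP; rewrite enorm_eq0 subr_eq0 => /eqP uv; apply: val_inj.
Qed.

Lemma sphere_dist_sym u v : sphere_dist u v = sphere_dist v u.
Proof. exact: enormB. Qed.

Lemma sphere_dist_triangle v u w :
  sphere_dist u w <= sphere_dist u v + sphere_dist v w.
Proof. by rewrite /sphere_dist -(subrKA (sphere_val v)) enormD. Qed.

HB.instance Definition _ := @isMetric.Build R sphere sphere_dist
  sphere_distxx sphere_dist_positivity sphere_dist_sym sphere_dist_triangle.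

Record orthobasis := OrthoBasis {
  basis_vec :> 'I_d -> 'rV[R]_d ;
  orthobasisP : forall i j, dot (basis_vec i) (basis_vec j) = (i == j)%:R }.

Lemma enorm_basis (e : orthobasis) i : enorm (e i) == 1.
Proof. by rewrite /enorm orthobasisP eqxx sqrtr1. Qed.

Definition basis_pt (e : orthobasis) (i : 'I_d) : sphere :=
  Sphere (enorm_basis e i).

End Sphere.

(* The quotient of the sphere by [u ~ v <-> |u_i| = |v_i| for all i], with
   the metric mu([u], [v]) = || phi [u] - phi [v] ||. *)
Section Quotient.
Variables (R : realType) (d : nat) (e : orthobasis R d).

Definition same_abs : rel (sphere R d) :=
  fun u v => [forall i, `|dot u (e i)| == `|dot v (e i)|].

Lemma same_abs_equiv : equiv_class_of same_abs.
Proof.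
split=> [u|u v|v u w]; first exact/forallP.
- by apply/forallP/forallP => uv i; rewrite eq_sym.
- move=> /forallP uv /forallP vw; apply/forallP => i.
  by rewrite (eqP (uv i)).
Qed.

Canonical same_abs_equivRel := EquivRelPack same_abs_equiv.

Definition sphere_quot : Type := {eq_quot same_abs_equivRel}%qT.

HB.instance Definition _ := Choice.on sphere_quot.
HB.instance Definition _ := EqQuotient.on sphere_quot.

Definition class_of_pt (u : sphere R d) : sphere_quot := (\pi_(sphere_quot) u)%qT.

Lemma class_of_ptP u v :
  class_of_pt u = class_of_pt v <->
  forall i, `|dot u (e i)| = `|dot v (e i)|.
Proof.
split=> [/eqmodP /forallP uv i|uv]; first exact/eqP.
by apply/eqmodP/forallP => i; apply/eqP.
Qed.

Definition phi (q : sphere_quot) : 'rV[R]_d :=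
  \sum_(i < d) `|dot (repr q : sphere R d) (e i)| *: e i.

Lemma phi_class u : phi (class_of_pt u) = \sum_(i < d) `|dot u (e i)| *: e i.
Proof.
apply: eq_bigr => i _; congr (_ *: _).
by apply: (class_of_ptP _ _).1; exact: reprK.
Qed.

Definition quot_dist (p q : sphere_quot) : R := enorm (phi p - phi q).

Lemma dot_phi q i : dot (phi q) (e i) = `|dot (repr q : sphere R d) (e i)|.
Proof.
rewrite dot_suml (bigD1 i) //= dotZl orthobasisP eqxx mulr1.
by rewrite big1 ?addr0 // => j /negPf ji; rewrite dotZl orthobasisP ji mulr0.
Qed.

Lemma quot_distxx p : quot_dist p p = 0.
Proof. by apply/eqP; rewrite /quot_dist subrr enorm_eq0. Qed.

Lemma quot_dist_positivity p q : quot_dist p q = 0 -> p = q.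
Proof.
move=> /eqP; rewrite enorm_eq0 subr_eq0 => /eqP pq.
rewrite -[p]reprK -[q]reprK; apply/class_of_ptP => i.
by rewrite -!dot_phi pq.
Qed.

Lemma quot_dist_sym p q : quot_dist p q = quot_dist q p.
Proof. exact: enormB. Qed.

Lemma quot_dist_triangle q p r :
  quot_dist p r <= quot_dist p q + quot_dist q r.
Proof. by rewrite /quot_dist -(subrKA (phi q)) enormD. Qed.

HB.instance Definition _ := @isMetric.Build R sphere_quot quot_dist
  quot_distxx quot_dist_positivity quot_dist_sym quot_dist_triangle.

End Quotient.

(* Derivatives relative to a subset: one-sided at an endpoint of an interval. *)
Section RelativeDerivative.
Context {R : realType}.
Implicit Types (A : set R) (f : R -> R).

Definition deriv_within A f (x l : R) : Prop :=
  (f y - f x) / (y - x) @[y --> within A x^'] --> l.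

Definition deriv2_within A f (x l : R) : Prop :=
  exists f1 : R -> R,
    (forall y, A y -> deriv_within A f y (f1 y)) /\ deriv_within A f1 x l.

Definition C2_on A f : Prop :=
  exists f2 : R -> R,
    (forall x, A x -> deriv2_within A f x (f2 x)) /\
    {within A, continuous f2}.

End RelativeDerivative.

Section Odeco.
Context {R : realType}.

Record contrast (g : R -> R) : Prop := Contrast {
  contrast_C2 : C2_on `[-1, 1]%classic g ;
  contrast_parity :
    (forall x : R, x \in `[-1, 1] -> g (- x) = g x) \/
    (forall x : R, x \in `[-1, 1] -> g (- x) = - g x) ;
  contrast_convexity :
    (forall x : R, x \in `]0, 1] ->
      exists2 l,
        deriv2_within `]0, 1]%classic (fun y => g (Num.sqrt y)) x l & 0 < l) \/
    (forall x : R, x \in `]0, 1] ->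
      exists2 l,
        deriv2_within `]0, 1]%classic (fun y => g (Num.sqrt y)) x l & 0 < - l) ;
  contrast_deriv0 : deriv_within `[0, 1]%classic (fun y => g (Num.sqrt y)) 0 0 ;
  contrast0 : g 0 = 0 }.

Definition unit_cball (d : nat) : set 'rV[R]_d := [set u | enorm u <= 1].

(* Only the values of [F] on the closed unit ball matter. *)
Definition odeco (d m : nat) (hmd : (m <= d)%N) (e : orthobasis R d)
    (g : 'I_m -> R -> R) (F : 'rV[R]_d -> R) : Prop :=
  (forall i, contrast (g i)) /\
  (forall u, unit_cball u ->
    F u = \sum_(i < m) g i (dot u (e (widen_ord hmd i)))).

(* [F] lives on the closed ball, so its gradient at a point of the sphere is
   the derivative relative to the ball; it is unique when it exists. *)
Definition is_gradient (d : nat) (F : 'rV[R]_d -> R) (u v : 'rV[R]_d) : Prop :=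
  (F w - F u - dot v (w - u)) / enorm (w - u)
    @[w --> within (@unit_cball d) u^'] --> (0 : R).

Definition gradient (d : nat) (F : 'rV[R]_d -> R) (u : 'rV[R]_d) : 'rV[R]_d :=
  xget 0 [set v | is_gradient F u v].

Lemma gradient_iter_subproof (d : nat) (u : sphere R d) (v : 'rV[R]_d) :
  enorm (if v == 0 then u : 'rV[R]_d else (enorm v)^-1 *: v) == 1.
Proof.
case: ifPn => [_|v0]; first exact: enorm_sphere.
by rewrite enormZ normfV ger0_norm ?enorm_ge0 // mulVf // enorm_eq0.
Qed.

Definition gradient_iter (d : nat) (F : 'rV[R]_d -> R) (u : sphere R d) :
  sphere R d := Sphere (gradient_iter_subproof u (gradient F u)).

(* For odeco [F] with hidden basis [e], the value does not depend on the
   chosen representative of the class. *)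
Definition gradient_iter_quot (d : nat) (e : orthobasis R d)
    (F : 'rV[R]_d -> R) (q : sphere_quot e) : sphere_quot e :=
  class_of_pt e (gradient_iter F (repr q)).

End Odeco.

Section Dynamics.
Context {T : topologicalType}.
Implicit Types (f : T -> T) (v : T).

Definition lyapunov_stable f v : Prop :=
  forall N, nbhs v N ->
    exists2 N', nbhs v N' & forall x, N' x -> forall n, N (iter n f x).

Definition attractor f v : Prop :=
  [/\ f v = v,
      lyapunov_stable f v &
      exists2 N, nbhs v N &
        forall x, N x -> iter n f x @[n --> \oo] --> v].

End Dynamics.

(* Hausdorff (outer) measure in dimension [s >= 1].  On the unit sphere of
   R^d, surface measure is a positive multiple of it for [s = d - 1]. *)
Section Hausdorff.
Context {R : realType} {T : metricType R}.
Implicit Types A : set T.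
Local Open Scope ereal_scope.

(* [maxe 0] only serves to give the empty set diameter 0. *)
Definition diam A : \bar R :=
  maxe 0 (ereal_sup [set (mdist p.1 p.2)%:E | p in A `*` A]).

Definition hausdorff_premeasure (s : nat) (delta : R) A : \bar R :=
  ereal_inf [set \sum_(0 <= k <oo) diam (U k) ^+ s | U in
    [set U : nat -> set T |
      A `<=` \bigcup_k U k /\ forall k, diam (U k) <= delta%:E]].

Definition hausdorff_measure (s : nat) A : \bar R :=
  ereal_sup [set hausdorff_premeasure s delta A | delta in
    [set delta : R | (0 < delta)%R]].

End Hausdorff.

Definition full_surface_measure (R : realType) (d : nat)
    (X : set (sphere R d)) : Prop :=
  hausdorff_measure d.-1 (~` X) = 0%E.

(* Main.v *)
(* In absolute hidden coordinates x_i = |u_i| the gradient iteration is the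
   normalized diagonal map x_i |-> b_i(x_i) with b_i = |g_i'|, and the
   convexity of g_i(sqrt t) says that log b_i is expanding in log x_i.

   Near a vertex e_i the other coordinates are at least halved at each step,
   because b_j(t) = o(t); this gives the attractors.  For the same reason a
   coordinate of an arbitrary orbit either stays above a fixed r > 0 or tends
   to 0.  Let S be the set of coordinates of the first kind; if S has one
   element, then the orbit converges to a vertex.

   If S has at least two elements, compare two such orbits x, y with the same
   S.  The oscillation of log(x_i / y_i) over S would grow geometrically if it
   dominated the differences off S; hence it is controlled by them, so that,
   after N steps, such points form a Lipschitz graph over the coordinates off
   S.  The oscillation of log(x_i / y_i) over all i <= m (Hilbert's projective
   metric) never decreases along the iteration, so this Lipschitz bound pulls
   back to the starting points.  They are thus covered by countably many sets
   with a Lipschitz parametrization by d - |S| < d - 1 real parameters, and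
   have surface measure zero. *)

Require Import Defs.
From HB Require Import structures.
From mathcomp Require Import all_boot all_order all_algebra.
From mathcomp Require Import all_classical all_reals all_analysis.
From mathcomp Require Import ring lra.

Set Implicit Arguments.
Unset Strict Implicit.
Unset Printing Implicit Defensive.

Import Order.TTheory GRing.Theory Num.Theory.
Import numFieldNormedType.Exports.

Local Open Scope classical_set_scope.
Local Open Scope ring_scope.

(** * Sets of Hausdorff measure zero *)

Section HausdorffNull.
Context {R : realType} {T : metricType R}.
Implicit Types A : set T.
Local Open Scope ereal_scope.

(** Why [log b_i] expands: with [g_i(y) = k(y^2)] one has [b_i(y) / y = 2 |k'(y^2)|], which
    increases strictly by (2), while [k'(0) = 0] gives [b_i(t) = o(t)]. Normalization multiplies all
    coordinates by a common factor. Differences of log-ratios do not see it, which is why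
    oscillations are followed; the factor itself is recovered from the unit norm, up to an error
    that is small when the coordinates off [S] are small. Two whole forward orbits are compared with
    each other, because no limit of either is known in advance. Countability rests on the order of
    choices. The bound [r] and the smallness threshold off [S] never depend on the orbit; a single
    orbit then determines a waiting time and a lower bound [1 / (k + 1)] for its coordinates up to
    that time. These integers, [S] and the signs of the coordinates index the cover. The parameters
    are read at two times: the first step annihilates the coordinates beyond [m], so these are
    recorded initially, and the other coordinates off [S] after the waiting time. *)

Definition hnull (s : nat) A : Prop := forall eps : R, (0 < eps)%R ->
  exists U : nat -> set T, A `<=` \bigcup_k U k /\
    \sum_(0 <= k <oo) diam (U k) ^+ s <= eps%:E.

Lemma diam_ge0 A : 0 <= diam A.
Proof. by rewrite /diam le_max lexx. Qed.

Lemma diam_le A (c : R) : (0 <= c)%R ->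
  (forall x y, A x -> A y -> (mdist x y <= c)%R) -> diam A <= c%:E.
Proof.
move=> c0 Ac; rewrite /diam ge_max lee_fin c0 /=.
apply: ge_ereal_sup => _ [[x y] [/= Ax Ay] <-]; rewrite lee_fin.
exact: Ac.
Qed.

Lemma lee_expe (x y : \bar R) n : 0 <= x -> x <= y -> x ^+ n <= y ^+ n.
Proof.
move=> x0 xy; elim: n => [|n IH]; first by rewrite !expe0.
by rewrite !expeS lee_pmul // expe_ge0.
Qed.

Lemma diam_set0 : diam (set0 : set T) = 0.
Proof. by apply/eqP; rewrite eq_le diam_ge0 diam_le. Qed.

(** [hnull] puts no mesh condition on the covers: if the sum is at most [delta ^ s], each set
    already has diameter at most [delta]. *)
Lemma hnull_measure (s : nat) A : (0 < s)%N -> hnull s A ->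
  hausdorff_measure s A = 0.
Proof.
move=> s0 Anull.
have pre0 (delta : R) : (0 < delta)%R -> hausdorff_premeasure s delta A = 0.
  move=> d0; apply/eqP; rewrite eq_le; apply/andP; split; last first.
    apply: le_ereal_inf_tmp => _ [U _ <-]; apply: nneseries_ge0 => k _ _.
    by rewrite expe_ge0 ?diam_ge0.
  apply/lee_addgt0Pr => e e0; rewrite add0e.
  have m0 : (0 < Num.min e (delta ^+ s))%R by rewrite lt_min e0 exprn_gt0.
  have [U [AU Ule]] := Anull _ m0.
  apply: (@le_trans _ _ (\sum_(0 <= k <oo) diam (U k) ^+ s)).
    apply: ereal_inf_lbound; exists U => //; split => // k.
    have Uks : diam (U k) ^+ s <= (delta ^+ s)%:E.
      apply: le_trans (le_trans Ule _); last by rewrite lee_fin ge_min lexx orbT.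
      apply: le_trans (nneseries_lim_ge k.+1 _); last first.
        by move=> n _ _; rewrite expe_ge0 ?diam_ge0.
      rewrite big_nat_recr //= leeDr // sume_ge0 // => i _.
      by rewrite expe_ge0 ?diam_ge0.
    have := diam_ge0 (U k); case: (diam (U k)) Uks => [r||] //=.
      rewrite -EFin_expe !lee_fin => rs r0.
      by rewrite -(@ler_pXn2r _ s) ?nnegrE // ltW.
    suff -> : +oo ^+ s = +oo :> \bar R by rewrite leye_eq.
    case: (s) s0 => // n _; elim: n => [|n IH]; first by [].
    by rewrite expeS IH mulyy.
  by rewrite (le_trans Ule) // lee_fin ge_min lexx.
apply/eqP; rewrite eq_le; apply/andP; split.
  by apply: ge_ereal_sup => _ [delta /= d0 <-]; rewrite pre0.
apply: ereal_sup_ubound; exists 1%R; rewrite ?pre0 //=; exact: ltr01.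
Qed.

Lemma hnullS (s : nat) A B : A `<=` B -> hnull s B -> hnull s A.
Proof.
move=> AB Bn e /Bn[U [BU Ule]]; exists U; split => //.
exact: subset_trans BU.
Qed.

Lemma hnull_bigcup (s : nat) (F : nat -> set T) :
  (forall n, hnull s (F n)) -> hnull s (\bigcup_n F n).
Proof.
move=> Fn eps e0.
have e2 n : (0 < eps / (2 ^ n.+1)%:R)%R by rewrite divr_gt0 // ltr0n expn_gt0.
have [G PG] := choice (fun n => Fn n _ (e2 n)).
have /card_esym/ppcard_eqP[f] := card_nat2.
pose a (p : nat * nat) := diam (G p.1 p.2) ^+ s.
have a0 p : 0 <= a p by rewrite expe_ge0 ?diam_ge0.
exists (fun k => G (f k).1 (f k).2); split.
  move=> t [n _ /(PG n).1[k _ Gt]]; exists (f^-1%FUN (n, k)) => //=.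
  by rewrite invK ?inE.
rewrite nneseries_esumT; last by move=> n; exact: (a0 (f n)).
rewrite -(@reindex_esum _ _ _ setT setT f a) //.
have -> : [set: nat * nat] = setT `*`` (fun=> [set: nat]).
  by apply/seteqP; split.
rewrite -(@esum_esum _ _ _ _ _ (fun i j => a (i, j))) //.
rewrite -nneseries_esumT; last by move=> n; exact: esum_ge0.
apply: le_trans (epsilon_trick0 xpredT (ltW e0)).
apply: lee_nneseries => n _; first by move=> *; exact: esum_ge0.
rewrite -nneseries_esumT; last by move=> k; exact: (a0 (n, k)).
exact: (PG n).2.
Qed.

(** The finite cover is padded with empty sets, which contribute [0 ^+ s = 0] because [s > 0]. *)
Lemma hnull_fin (s : nat) A : (0 < s)%N ->
  (forall eps : R, (0 < eps)%R -> exists (I : finType) (V : I -> set T) (c : R),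
    [/\ (0 <= c)%R, A `<=` \bigcup_i V i, forall i, diam (V i) <= c%:E &
        (#|I|%:R * c ^+ s <= eps)%R]) ->
  hnull s A.
Proof.
move=> s0 H eps /H[I [V [c [c0 AV Vc Ic]]]].
pose U k := if insub k is Some j then V (enum_val (j : 'I_#|I|)) else set0.
exists U; split.
  move=> t /AV[i _ Vt]; exists (enum_rank i) => //.
  by rewrite /U valK enum_rankK.
rewrite (@nneseries_split _ _ 0 #|I|); last first.
  by move=> k _; rewrite expe_ge0 ?diam_ge0.
rewrite add0n eseries0 ?adde0; last first.
  move=> k Ik _; rewrite /U insubF ?diam_set0; last by rewrite ltnNge Ik.
  by case: (s) s0 => // n _; rewrite expeS mul0e.
apply: (@le_trans _ _ (#|I|%:R * c ^+ s)%:E); last by rewrite lee_fin.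
rewrite -[X in X%:R]subn0 mulr_natl -sumr_const_nat -sumEFin.
apply: lee_sum => k _; rewrite EFin_expe; apply: lee_expe; rewrite ?diam_ge0 //.
rewrite /U; case: insubP => [j _ _|_]; first exact: Vc.
by rewrite diam_set0 lee_fin.
Qed.

Lemma hnull_countable_bigcup (I : countType) (s : nat) (F : I -> set T) :
  (0 < s)%N -> (forall i, hnull s (F i)) -> hnull s (\bigcup_i F i).
Proof.
move=> s0 Fn; pose H n := if unpickle n is Some i then F i else set0.
apply: (@hnullS _ _ (\bigcup_n H n)).
  by move=> t [i _ Ft]; exists (pickle i) => //; rewrite /H pickleK.
apply: hnull_bigcup => n; rewrite /H; case: unpickle => // e e0.
exists (fun=> set0); split => //.
rewrite eseries0 ?lee_fin ?ltW // => k _ _; rewrite diam_set0.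
by case: (s) s0 => // m _; rewrite expeS mul0e.
Qed.

(* A grid of mesh [1/(n+1)] on the parameters cuts [A] into at most
   [(n+2)^#|J|] pieces of diameter at most [2C/(n+1)]. *)
Lemma hnull_param (J : finType) (s : nat) A (f : T -> J -> R) (C : R) :
  (#|J| < s)%N -> (0 <= C)%R ->
  (forall u j, A u -> (0 <= f u j <= 1)%R) ->
  (forall u v (t : R), A u -> A v -> (0 <= t)%R ->
     (forall j, `|f u j - f v j| <= t)%R -> (mdist u v <= C * t)%R) ->
  hnull s A.
Proof.
move=> Js C0 f01 fL; apply: hnull_fin => [|eps e0]; first exact: leq_ltn_trans Js.
(* Since [n + 2 <= 2 (n + 1)] and [#|J| + 1 <= s], the total over the grid, [(n + 2)^#|J|] times
   [(2C / (n + 1))^s], is at most [K / (n + 1)]. *)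
pose K : R := (2 ^+ #|J| * (2 * C) ^+ s)%R.
have K0 : (0 <= K)%R by rewrite mulr_ge0 // exprn_ge0 // mulr_ge0.
pose n := Num.truncn (K / eps)%R.
have Kn : (K / n.+1%:R <= eps)%R.
  rewrite ler_pdivrMr ?ltr0n // mulrC -ler_pdivrMr //.
  by have /andP[_ /ltW] := Num.Theory.truncn_itv (divr_ge0 K0 (ltW e0)).
have n0 : (0 < n.+1%:R :> R)%R by rewrite ltr0n.
exists {ffun J -> 'I_n.+2}.
exists (fun c : {ffun J -> 'I_n.+2} => [set u | A u /\
  forall j, `|f u j - (c j)%:R / n.+1%:R| <= n.+1%:R^-1]%R).
exists (2 * C / n.+1%:R)%R; split.
- by rewrite divr_ge0 // mulr_ge0.
- move=> u Au.
  exists [ffun j => inord (Num.truncn (f u j * n.+1%:R)%R)] => //=; split => // j.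
  have /andP[fu0 fu1] := f01 u j Au.
  have fn0 : (0 <= f u j * n.+1%:R)%R by rewrite mulr_ge0.
  have /andP[t1 t2] := truncn_itv fn0.
  rewrite ffunE inordK; last first.
    by rewrite ltnS -(ler_nat R) (le_trans t1) // ler_piMl.
  rewrite -[X in (X - _)%R](mulfK (lt0r_neq0 n0)) -mulrBl normrM.
  have i0 : (0 <= n.+1%:R^-1 :> R)%R by rewrite invr_ge0.
  rewrite (ger0_norm i0) ler_piMl // ger0_norm ?subr_ge0 //.
  by rewrite lerBlDl natr1 ltW.
- move=> c; apply: diam_le; first by rewrite divr_ge0 // mulr_ge0.
  move=> u v [Au fu] [Av fv].
  apply: (le_trans (fL u v (2 / n.+1%:R)%R Au Av _ _)).
  + by rewrite divr_ge0.
  + move=> j; rewrite -(subrKA ((c j)%:R / n.+1%:R)%R).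
    apply: (le_trans (ler_normD _ _)).
    by rewrite [(2 / _)%R]mulrDl mul1r lerD // distrC.
  + by rewrite le_eqVlt; apply/orP; left; apply/eqP; ring.
- apply: le_trans Kn; rewrite card_ffun card_ord natrX.
  rewrite [X in (_ * X)%R]exprMn exprVn /K.
  have h1 : (n.+2%:R ^+ #|J| <= 2 ^+ #|J| * n.+1%:R ^+ #|J| :> R)%R.
    rewrite -exprMn lerXn2r ?nnegrE ?mulr_ge0 // -natrM ler_nat mul2n -addnn.
    by rewrite addnS ltnS leq_addr.
  have h2 : (n.+1%:R ^+ #|J| * (n.+1%:R ^+ s)^-1 <= n.+1%:R^-1 :> R)%R.
    rewrite -[s](subnKC Js) exprD exprS.
    rewrite invfM [(n.+1%:R * _)^-1%R]invfM mulrA mulrA [(_ * n.+1%:R^-1)%R]mulrC.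
    rewrite mulfK ?expf_neq0 ?lt0r_neq0 //.
    rewrite ler_piMr ?invr_ge0 // invf_le1 ?exprn_gt0 // exprn_ege1 //.
    by rewrite ler1n.
  have C2 : (0 <= (2 * C) ^+ s)%R by rewrite exprn_ge0 // mulr_ge0.
  rewrite mulrA; apply: (@le_trans _ _
    (2 ^+ #|J| * n.+1%:R ^+ #|J| * (2 * C) ^+ s / n.+1%:R ^+ s)%R).
    by rewrite ler_wpM2r ?invr_ge0 ?exprn_ge0 // ler_wpM2r.
  rewrite [leLHS](_ : _ = (2 ^+ #|J| * (2 * C) ^+ s *
    (n.+1%:R ^+ #|J| * (n.+1%:R ^+ s)^-1))%R); last by ring.
  by rewrite ler_wpM2l.
Qed.

End HausdorffNull.

(** * Relative derivatives *)

Section RelativeDerivativeTheory.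
Context {R : realType}.
Implicit Types (A : set R) (f : R -> R).

(** Clearing the denominator admits [y = x], so that punctured neighbourhoods disappear from the
    later estimates. *)
Lemma deriv_withinP A f x l : deriv_within A f x l <->
  forall e, 0 < e -> exists2 r, 0 < r & forall y, A y -> `|y - x| < r ->
    `|f y - f x - l * (y - x)| <= e * `|y - x|.
Proof.
rewrite /deriv_within; split => [/cvgrPdist_le H e e0|H].
  have /nbhs_ballP[r /= r0 Hr] := H e e0.
  exists r => // y Ay xy; have [->|yx] := eqVneq y x.
    by rewrite !subrr mulr0 subrr normr0 mulr0.
  have := Hr y; rewrite -ball_normE /= distrC => /(_ xy yx Ay).
  have yx0 : 0 < `|y - x| by rewrite normr_gt0 subr_eq0.
  rewrite -(ler_pM2r yx0) -normrM mulrBl divfK ?subr_eq0 // distrC.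
  by move=> /le_trans; apply.
apply/cvgrPdist_le => e e0; have [r r0 Hr] := H e e0.
apply/nbhs_ballP; exists r => //= y; rewrite -ball_normE /= distrC => yr yx Ay.
have yx0 : 0 < `|y - x| by rewrite normr_gt0 subr_eq0.
rewrite -(ler_pM2r yx0) -normrM mulrBl divfK ?subr_eq0 // distrC.
exact: Hr.
Qed.

Lemma deriv_withinS A B f x l : A `<=` B -> deriv_within B f x l ->
  deriv_within A f x l.
Proof.
move=> AB /deriv_withinP H; apply/deriv_withinP => e /H[r r0 Hr].
by exists r => // y /AB; exact: Hr.
Qed.

Lemma deriv_within_unique A f x l l' :
  (forall r, 0 < r -> exists y, [/\ A y, y != x & `|y - x| < r]) ->
  deriv_within A f x l -> deriv_within A f x l' -> l = l'.
Proof.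
move=> acc /deriv_withinP fl /deriv_withinP fl'; apply/eqP.
rewrite -subr_eq0 -normr_le0; apply/ler_addgt0Pr => e e0; rewrite add0r.
have e20 : 0 < e / 2 by rewrite divr_gt0.
have [r r0 Hr] := fl _ e20; have [r' r'0 Hr'] := fl' _ e20.
have [|y [Ay yx]] := acc (Num.min r r'); first by rewrite lt_min r0.
rewrite lt_min => /andP[yr yr'].
have yx0 : 0 < `|y - x| by rewrite normr_gt0 subr_eq0.
rewrite -(ler_pM2r yx0) -normrM.
have -> : (l - l') * (y - x) =
  (f y - f x - l' * (y - x)) - (f y - f x - l * (y - x)) by ring.
apply: (le_trans (ler_normB _ _)); rewrite [e]splitr mulrDl lerD //.
  exact: Hr'.
exact: Hr.
Qed.

Lemma deriv_within_eqfun A f h x l : A x -> (forall y, A y -> f y = h y) ->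
  deriv_within A f x l -> deriv_within A h x l.
Proof.
move=> Ax fh /deriv_withinP H; apply/deriv_withinP => e /H[r r0 Hr].
by exists r => // y Ay; rewrite -!fh //; exact: Hr.
Qed.

Lemma deriv_withinZ A f c x l : deriv_within A f x l ->
  deriv_within A (fun y => c * f y) x (c * l).
Proof.
move=> /deriv_withinP H; apply/deriv_withinP => e e0.
have [|r r0 Hr] := H (e / (`|c| + 1)).
  by rewrite divr_gt0 // ltr_wpDl.
exists r => // y Ay /Hr - /(_ Ay) {}Hr.
have -> : c * f y - c * f x - c * l * (y - x) =
  c * (f y - f x - l * (y - x)) by ring.
have c0 : 0 < `|c| + 1 by rewrite ltr_wpDl.
rewrite normrM; apply: (@le_trans _ _ ((`|c| + 1) * (e / (`|c| + 1) * `|y - x|))).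
  by rewrite ler_pM // lerDl.
by rewrite mulrA mulrCA divff ?lt0r_neq0 // mulr1.
Qed.

(** At interior points the relative derivative is the two-sided one; this gives access to the chain
    rule and the mean value theorem. *)
Lemma deriv_within_is_derive A f x l : nbhs x A -> deriv_within A f x l ->
  is_derive x 1 f l.
Proof.
move=> /nbhs_ballP[s /= s0 sA] /deriv_withinP H.
have fl : h^-1 *: ((f \o shift x) (h *: 1) - f x) @[h --> 0^'] --> l.
  apply/cvgrPdist_le => e e0; have [r r0 Hr] := H e e0.
  apply/nbhs_ballP; exists (Num.min r s) => /=; first by rewrite lt_min r0.
  move=> h; rewrite -ball_normE /= sub0r normrN lt_min => /andP[hr hs] h0.
  have hx : h + x - x = h by rewrite addrK.
  have := Hr (h + x); rewrite hx /= => /(_ _ hr) Hh.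
  have {}Hh : `|f (h + x) - f x - l * h| <= e * `|h|.
    by apply: Hh; apply: sA; rewrite -ball_normE /= opprD addrCA subrr addr0 normrN.
  rewrite /= /shift /= [h *: 1]mulr1.
  have h1 : 0 < `|h| by rewrite normr_gt0.
  rewrite -(ler_pM2r h1) -normrM mulrBl distrC.
  by rewrite [h^-1 *: _]mulrC divfK.
by apply: DeriveDef; [apply/cvg_ex; exists l | exact: cvg_lim].
Qed.

Lemma deriv_within_continuous A f f' :
  (forall x, A x -> deriv_within A f x (f' x)) -> {within A, continuous f}.
Proof.
move=> H; apply/subspace_continuousP => x Ax.
apply/cvgrPdist_le => e e0.
have /deriv_withinP/(_ _ ltr01)[r r0 Hr] := H x Ax.
have c0 : 0 < 1 + `|f' x| by rewrite ltr_wpDr.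
apply/nbhs_ballP; exists (Num.min r (e / (1 + `|f' x|))) => /=.
  by rewrite lt_min r0 divr_gt0.
move=> y; rewrite -ball_normE /= distrC lt_min => /andP[yr ye] Ay.
rewrite distrC -[f y - f x](subrK (f' x * (y - x))).
apply: (le_trans (ler_normD _ _)); apply: (@le_trans _ _ ((1 + `|f' x|) * `|y - x|)).
  by rewrite mulrDl lerD ?normrM //; exact: Hr.
by rewrite mulrC -ler_pdivlMr // ltW.
Qed.

Lemma within_continuousP A f : {within A, continuous f} <->
  forall x, A x -> forall e, 0 < e -> exists2 r, 0 < r &
    forall y, A y -> `|y - x| < r -> `|f y - f x| <= e.
Proof.
split => [/subspace_continuousP H x Ax e e0|H].
  have /cvgrPdist_le/(_ e e0)/nbhs_ballP[r /= r0 Hr] := H x Ax.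
  exists r => // y Ay yr; rewrite distrC; apply: Hr => //.
  by rewrite -ball_normE /= distrC.
apply/subspace_continuousP => x Ax; apply/cvgrPdist_le => e e0.
have [r r0 Hr] := H x Ax e e0.
apply/nbhs_ballP; exists r => //= y; rewrite -ball_normE /= distrC => yr Ay.
by rewrite distrC; exact: Hr.
Qed.

Lemma derive_nondecreasing f f' (a b : R) : a <= b ->
  (forall x, x \in `]a, b[ -> is_derive x 1 f (f' x)) ->
  {within `[a, b], continuous f} ->
  (forall x, x \in `]a, b[ -> 0 <= f' x) -> f a <= f b.
Proof.
rewrite le_eqVlt => /predU1P[<- //|ab fd fc f'c].
have [x xab E] := MVT ab fd fc.
rewrite -subr_ge0 E; apply: mulr_ge0; first exact: f'c.
by rewrite subr_ge0 ltW.
Qed.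

End RelativeDerivativeTheory.

(** * Derivatives of contrast functions *)

Section Amplifier.
Context {R : realType}.

(* The last three fields bound the slope of [log b] as a function of [log x];
   [amp_ln_gt] stays away from [1], where [b] is only differentiable from the
   left. *)
Record amplifier (b : R -> R) : Prop := Amplifier {
  amp0 : b 0 = 0 ;
  amp_gt0 : forall x, 0 < x <= 1 -> 0 < b x ;
  amp_lip : exists2 K, 0 < K & forall x y, 0 <= x <= 1 -> 0 <= y <= 1 ->
    `|b x - b y| <= K * `|x - y| ;
  amp_small : forall e, 0 < e -> exists2 r, 0 < r &
    forall x y, 0 <= x <= r -> 0 <= y <= r -> `|b x - b y| <= e * `|x - y| ;
  amp_ln_ge : forall y x, 0 < y -> y <= x -> x <= 1 ->
    ln x - ln y <= ln (b x) - ln (b y) ;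
  amp_ln_gt : forall r s, 0 < r -> s < 1 -> exists2 p, 1 < p &
    forall y x, r <= y -> y <= x -> x <= s ->
      p * (ln x - ln y) <= ln (b x) - ln (b y) ;
  amp_ln_le : forall r, 0 < r -> exists2 q, 0 < q &
    forall y x, r <= y -> y <= x -> x <= 1 ->
      ln (b x) - ln (b y) <= q * (ln x - ln y) }.

Lemma derive_lipschitz (f f' : R -> R) (K a b : R) :
  (forall x : R, x \in `]a, b[ -> is_derive x 1 f (f' x)) ->
  {within `[a, b], continuous f} ->
  (forall x, x \in `]a, b[ -> `|f' x| <= K) ->
  forall x y, a <= x <= b -> a <= y <= b -> `|f x - f y| <= K * `|x - y|.
Proof.
move=> fd fc f'K.
have main x y : a <= x -> x <= y -> y <= b -> `|f y - f x| <= K * (y - x).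
  move=> ax xy yb.
  have sub z : z \in `]x, y[ -> z \in `]a, b[.
    rewrite !in_itv /= => /andP[xz zy].
    by rewrite (le_lt_trans ax xz) (lt_le_trans zy yb).
  have fxy : {within `[x, y], continuous f}.
    apply: continuous_subspaceW fc => z /=; rewrite !in_itv /= => /andP[xz zy].
    by rewrite (le_trans ax xz) (le_trans zy yb).
  move: xy; rewrite le_eqVlt => /predU1P[<-|xy].
    by rewrite !subrr normr0 mulr0.
  have [z zxy ->] := MVT xy (fun z h => fd z (sub z h)) fxy.
  rewrite normrM (gtr0_norm (x := y - x)) ?subr_gt0 //.
  by apply: ler_wpM2r; [rewrite subr_ge0 ltW | exact/f'K/sub].
move=> x y /andP[ax xb] /andP[ay yb]; have [xy|/ltW xy] := leP x y.
  rewrite distrC (distrC x) (ger0_norm (x := y - x)) ?subr_ge0 //; exact: main.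
by rewrite (ger0_norm (x := x - y)) ?subr_ge0 //; exact: main.
Qed.

(** * Amplifiers from a bound on the logarithmic slope *)

Section AmplifierOfDerivative.
Variables b b' : R -> R.
Hypothesis bd : forall x : R, x \in `]0, 1[ -> is_derive x 1 b (b' x).
Hypothesis bc : {within `[0, 1], continuous b}.
Hypothesis b'c : {within `[0, 1], continuous b'}.
Hypothesis b0 : b 0 = 0.
Hypothesis b'0 : b' 0 = 0.
Hypothesis b_gt0 : forall x : R, 0 < x <= 1 -> 0 < b x.
Hypothesis b_lt : forall x : R, 0 < x < 1 -> b x < x * b' x.

Let lnb_within (r s : R) : 0 < r -> s <= 1 ->
  forall c : R, {within `[r, s], continuous (fun x => ln (b x) - c * ln x)}.
Proof.
move=> r0 s1 c; apply/subspace_continuousP => x /=.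
rewrite in_itv /= => /andP[rx xs].
have x0 : 0 < x by exact: lt_le_trans rx.
have bx0 : 0 < b x by apply: b_gt0; rewrite x0 (le_trans xs).
have cb : b z @[z --> within `[r, s] (nbhs x)] --> b x.
  have bc' : {within `[r, s], continuous b}.
    apply: continuous_subspaceW bc => z /=; rewrite !in_itv /= => /andP[rz zs].
    by rewrite (le_trans (ltW r0) rz) (le_trans zs).
  by have /subspace_continuousP := bc'; apply; rewrite /= in_itv /= rx.
apply: cvgB.
  by apply: (cvg_comp _ _ cb); exact: continuous_ln.
apply: cvgM; first exact: cvg_cst.
apply: cvg_within_filter; exact: continuous_ln.
Qed.

Let lnb_derive (c x : R) : x \in `]0, 1[ ->
  is_derive x 1 (fun x : R => ln (b x) - c * ln x) (b' x / b x - c / x).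
Proof.
move=> x01; have := x01; rewrite in_itv /= => /andP[x0 x1].
have bx0 : 0 < b x by apply: b_gt0; rewrite x0 ltW.
have h1 : is_derive x 1 (@ln R \o b) ((b x)^-1 * b' x).
  by apply: is_derive1_comp; [exact: is_derive1_ln | exact: bd].
have h2 : is_derive x 1 (c \*: (@ln R)) (c *: x^-1).
  by apply: is_deriveZ; exact: is_derive1_ln.
have := is_deriveB h1 h2; rewrite mulrC => h3; exact: h3.
Qed.

(** [x * b' x / b x] is the derivative of [log b] with respect to [log x]; where it is at least [c],
    the function [ln b - c ln] is nondecreasing. *)
Let log_slope (c r s : R) : 0 < r -> s <= 1 ->
  (forall x, r < x < s -> c <= x * b' x / b x) ->
  forall y x, r <= y -> y <= x -> x <= s ->
    c * (ln x - ln y) <= ln (b x) - ln (b y).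
Proof.
move=> r0 s1 H y x ry yx xs.
have y0 : 0 < y by exact: lt_le_trans ry.
have x1 : x <= 1 by exact: le_trans xs s1.
pose phi z := ln (b z) - c * ln z.
suff : phi y <= phi x by rewrite /phi mulrBr; lra.
have phid z : z \in `]y, x[ -> is_derive z 1 phi (b' z / b z - c / z).
  rewrite in_itv /= => /andP[yz zx]; apply: lnb_derive.
  by rewrite in_itv /= (lt_trans y0 yz) (lt_le_trans zx).
have phic : {within `[y, x], continuous phi} by exact: lnb_within.
apply: (derive_nondecreasing yx phid phic) => z.
rewrite in_itv /= => /andP[yz zx].
have z0 : 0 < z by exact: lt_trans yz.
have := H z; rewrite (le_lt_trans ry yz) (lt_le_trans zx xs) => /(_ isT).
by rewrite subr_ge0 ler_pdivrMr // (mulrC z) mulrAC.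
Qed.

Let slope_within (r s : R) : 0 < r -> s <= 1 ->
  {within `[r, s], continuous (fun x => x * b' x / b x)}.
Proof.
move=> r0 s1; apply/subspace_continuousP => x /=.
rewrite in_itv /= => /andP[rx xs].
have x0 : 0 < x by exact: lt_le_trans rx.
have bx0 : 0 < b x by apply: b_gt0; rewrite x0 (le_trans xs).
have cb (f : R -> R) : {within `[0, 1], continuous f} ->
    f z @[z --> within `[r, s] (nbhs x)] --> f x.
  move=> fc; have fc' : {within `[r, s], continuous f}.
    apply: continuous_subspaceW fc => z /=; rewrite !in_itv /= => /andP[rz zs].
    by rewrite (le_trans (ltW r0) rz) (le_trans zs).
  by have /subspace_continuousP := fc'; apply; rewrite /= in_itv /= rx.
apply: cvgM; last by apply: cvgV; [rewrite gt_eqF | exact: cb].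
apply: cvgM; last exact: cb.
apply: cvg_within_filter; exact: cvg_id.
Qed.

(** [b_lt] says that the logarithmic slope exceeds 1 on []0, 1[]. Its minimum on [[r, s]] with
    [s < 1] is then a constant [p > 1], and its maximum on [[r, 1]] yields [q]; the two Lipschitz
    bounds come from the continuity of [b'] and from [b' 0 = 0]. *)
Lemma amplifier_of_derivative : amplifier b.
Proof.
split => //.
- have [c _ cmax] := EVT_max ler01 b'c; have [c' _ cmin] := EVT_min ler01 b'c.
  exists (`|b' c| + `|b' c'| + 1); first by rewrite ltr_wpDl // addr_ge0.
  apply: derive_lipschitz => // x; rewrite in_itv /= => /andP[x0 x1].
  have x01 : x \in `[0, 1] by rewrite in_itv /= !ltW.
  have := cmax x x01; have := cmin x x01.
  have := ler_norm (b' c); have := ler_norm (- b' c'); rewrite normrN.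
  have := normr_ge0 (b' c); have := normr_ge0 (b' c').
  by rewrite ler_norml; lra.
- move=> e e0.
  have /within_continuousP/(_ 0) := b'c.
  rewrite /= in_itv /= lexx ler01 => /(_ isT e e0)[r r0 Hr].
  exists (Num.min (r / 2) 1); first by rewrite lt_min divr_gt0 //=.
  set t := Num.min _ _.
  have tr : t <= r / 2 by rewrite /t ge_min lexx.
  have t1 : t <= 1 by rewrite /t ge_min lexx orbT.
  apply: (@derive_lipschitz b b').
  + move=> x; rewrite in_itv /= => /andP[x0 xt]; apply: bd.
    by rewrite in_itv /= x0 (lt_le_trans xt).
  + apply: continuous_subspaceW bc => z /=; rewrite !in_itv /= => /andP[-> zs].
    by rewrite (le_trans zs).
  + move=> x; rewrite in_itv /= => /andP[x0 xt].
    have := Hr x; rewrite b'0 !subr0; apply.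
      by rewrite /= in_itv /= !ltW // (lt_le_trans xt).
    rewrite gtr0_norm // (lt_trans (lt_le_trans xt tr)) //.
    by rewrite ltr_pdivrMr // ltr_pMr // ltr1n.
- move=> y x y0 yx x1; rewrite -[leLHS]mul1r.
  apply: (@log_slope 1 y 1) => // z /andP[yz z1].
  have z0 : 0 < z by exact: lt_trans yz.
  rewrite ler_pdivlMr; first by rewrite mul1r ltW // b_lt // z0.
  by apply: b_gt0; rewrite z0 ltW.
- move=> r s r0 s1; have [rs|sr] := leP r s; last first.
    exists 2; first by rewrite ltr1n.
    move=> y x ry yx xs; exfalso.
    by have := le_trans (le_trans ry yx) xs; rewrite leNgt sr.
  have [c] := EVT_min rs (slope_within r0 (ltW s1)).
  rewrite in_itv /= => /andP[rc cs] cmin.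
  have c0 : 0 < c by exact: lt_le_trans rc.
  have c1 : c < 1 by exact: le_lt_trans s1.
  exists (c * b' c / b c).
    rewrite ltr_pdivlMr ?mul1r; first by apply: b_lt; rewrite c0.
    by apply: b_gt0; rewrite c0 ltW.
  move=> y x; apply: log_slope => //; first exact: ltW.
  by move=> z /andP[rz zs]; apply: cmin; rewrite in_itv /= !ltW.
- move=> r r0; have [r1|r1] := leP r 1; last first.
    exists 1 => // y x ry yx x1; exfalso.
    by have := le_trans (le_trans ry yx) x1; rewrite leNgt r1.
  have [c _ cmax] := EVT_max r1 (slope_within r0 (lexx 1)).
  pose q : R := `|c * b' c / b c| + 1.
  exists q; first by rewrite ltr_wpDl.
  move=> y x ry yx x1.
  have y0 : 0 < y by exact: lt_le_trans ry.
  pose phi z := - (ln (b z) - q * ln z).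
  suff : phi y <= phi x by rewrite /phi mulrBr; lra.
  have phid z : z \in `]y, x[ -> is_derive z 1 phi (- (b' z / b z - q / z)).
    rewrite in_itv /= => /andP[yz zx].
    have : is_derive z 1 (fun x : R => ln (b x) - q * ln x) (b' z / b z - q / z).
      by apply: lnb_derive; rewrite in_itv /= (lt_trans y0 yz) (lt_le_trans zx).
    by move/is_deriveN.
  have phic : {within `[y, x], continuous phi}.
    apply/subspace_continuousP => z zi; apply: cvgN.
    have lc : {within `[y, x], continuous (fun z => ln (b z) - q * ln z)}.
      exact: lnb_within.
    by have /subspace_continuousP := lc; apply.
  apply: (derive_nondecreasing yx phid phic) => z.
  rewrite in_itv /= => /andP[yz zx].
  have z0 : 0 < z by exact: lt_trans yz.
  rewrite oppr_ge0 subr_le0 ler_pdivlMr // mulrAC (mulrC _ z).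
  apply: le_trans (cmax z _) _.
    by rewrite in_itv /= (le_trans ry (ltW yz)) (le_trans (ltW zx)).
  by rewrite (le_trans (ler_norm _)) // lerDl.
Qed.

End AmplifierOfDerivative.
End Amplifier.

(** * Sign and vanishing order of the derivative *)

Section ContrastAmplifier.
Context {R : realType}.

Section PositiveSlope.
Variables f b b' : R -> R.
Hypothesis fd : forall x : R, x \in `]0, 1[ -> is_derive x 1 f (b x).
Hypothesis fc : {within `[0, 1], continuous f}.
Hypothesis f0 : f 0 = 0.
Hypothesis f_small : forall e : R, 0 < e -> exists2 r, 0 < r &
  forall y, 0 <= y <= r -> `|f y| <= e * y ^+ 2.
Hypothesis bd : forall x : R, x \in `]0, 1[ -> is_derive x 1 b (b' x).
Hypothesis bc : {within `[0, 1], continuous b}.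
Hypothesis bd0 : deriv_within `[0, 1] b 0 (b' 0).
Hypothesis b_lt : forall x : R, 0 < x < 1 -> b x < x * b' x.

(** The derivative of [b z / z] is [(z b' - b) / z^2], positive by [b_lt]. *)
Lemma slope_increasing x y : 0 < x -> x < y -> y <= 1 -> b x / x < b y / y.
Proof.
move=> x0 xy y1.
have phid z : z \in `]x, y[ ->
    is_derive z 1 (b * @GRing.inv R : R -> R) ((z * b' z - b z) / z ^+ 2).
  rewrite in_itv /= => /andP[xz zy].
  have z0 : 0 < z by exact: lt_trans xz.
  have hb : is_derive z 1 b (b' z).
    by apply: bd; rewrite in_itv /= z0 (lt_le_trans zy).
  have hi : is_derive z 1 (@GRing.inv R) (- z ^- 2 *: 1).
    by have := @is_deriveV R id z 1 1 (lt0r_neq0 z0) (is_derive_id z 1).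
  apply: (is_derive_eq (is_deriveM hb hi)).
  rewrite /GRing.scale /=; field; exact: lt0r_neq0.
have phic : {within `[x, y], continuous (b * @GRing.inv R : R -> R)}.
  apply/subspace_continuousP => z zi; have := zi; rewrite /= in_itv /=.
  move=> /andP[xz zy]; apply: cvgM.
    have bc' : {within `[x, y], continuous b}.
      apply: continuous_subspaceW bc => w /=; rewrite !in_itv /= => /andP[rz zs].
      by rewrite (le_trans (ltW x0) rz) (le_trans zs).
    by have /subspace_continuousP := bc'; apply.
  apply: cvgV; first by rewrite gt_eqF // (lt_le_trans x0).
  by apply: cvg_within_filter; exact: cvg_id.
have [c] := MVT xy phid phic.
rewrite in_itv /= => /andP[xc cy] E.
have c0 : 0 < c by exact: lt_trans xc.
rewrite -subr_gt0 [ltRHS]E mulr_gt0 ?subr_gt0 // divr_gt0 ?exprn_gt0 //.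
by rewrite subr_gt0 b_lt // c0 (lt_le_trans cy).
Qed.

(** A linear bound on [b = f'] is integrated to a quadratic bound on [f]; the sign [s] covers upper
    and lower bounds at once. *)
Let quad_mono (s c u : R) : u <= 1 -> 0 <= u ->
  (forall z, 0 < z < u -> 0 <= s * b z + 2 * c * z) ->
  0 <= s * f u + c * u ^+ 2.
Proof.
move=> u1 u0 H.
pose phi : R -> R := s \*: f + c \*: (fun z : R => z ^+ 2).
have -> : 0 = phi 0 by rewrite /phi fctE /= f0 expr0n /= !scaler0 addr0.
have phid z : z \in `]0, u[ -> is_derive z 1 phi (s * b z + 2 * c * z).
  rewrite in_itv /= => /andP[z0 zu].
  have h1 : is_derive z 1 (s \*: f) (s *: b z).
    by apply: is_deriveZ; apply: fd; rewrite in_itv /= z0 (lt_le_trans zu).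
  have h2 : is_derive z 1 (c \*: (fun z : R => z ^+ 2)) (c *: (2 * z)).
    apply: is_deriveZ.
    apply: (is_derive_eq (is_deriveM (is_derive_id z 1) (is_derive_id z 1))).
    by rewrite /GRing.scale /= mulr1 mulr_natl.
  apply: (is_derive_eq (is_deriveD h1 h2)).
  by rewrite /GRing.scale /= mulrCA mulrA.
have phic : {within `[0, u], continuous phi}.
  apply/subspace_continuousP => z zi; apply: cvgD.
    apply: cvgZr.
    have fc' : {within `[0, u], continuous f}.
      apply: continuous_subspaceW fc => w /=; rewrite !in_itv /= => /andP[-> zs].
      by rewrite (le_trans zs).
    by have /subspace_continuousP := fc'; apply.
  apply: cvgZr; apply: cvg_within_filter; exact: exprn_continuous.
by apply: (derive_nondecreasing u0 phid phic) => z; rewrite in_itv /= => /H.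
Qed.

(* If [b x0 <= 0] then [b y <= - 2 c y] near [0] for some [c > 0], hence
   [f y <= - c y^2], against [f y = o(y^2)]. *)
Lemma slope_gt0 x : 0 < x <= 1 -> 0 < b x.
Proof.
move=> /andP[x0 x1]; rewrite ltNge; apply/negP => bx0.
(* Passing to [x / 2] turns [b x <= 0] into the strict inequality [b x2 / x2 < 0], which makes [c]
   positive. *)
pose x2 := x / 2.
have x20 : 0 < x2 by rewrite divr_gt0.
have x2x : x2 < x by rewrite ltr_pdivrMr // ltr_pMr // ltr1n.
pose c := - (b x2 / x2) / 2.
have c0 : 0 < c.
  rewrite divr_gt0 // oppr_gt0; apply: lt_le_trans (slope_increasing x20 x2x x1) _.
  by rewrite pmulr_lle0 ?invr_gt0.
have [r r0 Hr] := f_small (divr_gt0 c0 (ltr0n R 2)).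
pose u := Num.min r x2.
have u0 : 0 < u by rewrite lt_min r0.
have ux2 : u <= x2 by rewrite ge_min lexx orbT.
have u1 : u <= 1 by apply: le_trans ux2 (le_trans (ltW x2x) x1).
have := @quad_mono (-1) (- c) u u1 (ltW u0).
have Hu : `|f u| <= c / 2 * u ^+ 2 by apply: Hr; rewrite ltW //= ge_min lexx.
have fu : - f u <= `|f u| by rewrite -normrN ler_norm.
have u20 : 0 < u ^+ 2 by rewrite exprn_gt0.
have cu : 0 < c * u ^+ 2 by rewrite mulr_gt0.
move=> H; suff : 0 <= - 1 * f u + - c * u ^+ 2 by move: Hu; rewrite mulrAC; lra.
apply: H => z /andP[z0 zu].
have /ltW := slope_increasing z0 (lt_le_trans zu ux2) (le_trans (ltW x2x) x1).
rewrite ler_pdivrMr // => bz.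
suff -> : -1 * b z + 2 * - c * z = b x2 / x2 * z - b z by rewrite subr_ge0.
by rewrite /c; field; rewrite lt0r_neq0.
Qed.

(** As [b y / y] increases, [0 < b y < y * b 1] for [0 < y < 1]; continuity at 0 concludes. *)
Lemma slope0 : b 0 = 0.
Proof.
have b1 : 0 < b 1 by apply: slope_gt0; rewrite ltr01 lexx.
apply/eqP; rewrite -normr_le0; apply/ler_addgt0Pr => e e0; rewrite add0r.
have /within_continuousP/(_ 0) := bc.
rewrite /= in_itv /= lexx ler01 => /(_ isT (e / 2))[|r r0 Hr].
  by rewrite divr_gt0.
pose y := Num.min (Num.min (r / 2) (1 / 2)) (e / 2 / b 1).
have y0 : 0 < y by rewrite !lt_min !divr_gt0.
have yr : y < r.
  rewrite /y !gt_min; apply/orP; left; apply/orP; left.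
  by rewrite ltr_pdivrMr // ltr_pMr // ltr1n.
have y1 : y < 1.
  rewrite /y !gt_min; apply/orP; left; apply/orP; right.
  by rewrite ltr_pdivrMr // mul1r ltr1n.
have ye : y <= e / 2 / b 1 by rewrite /y ge_min lexx orbT.
have y01 : 0 <= y <= 1 by rewrite !ltW.
have := Hr y; rewrite /= in_itv /= y01 subr0 gtr0_norm // => /(_ isT yr).
have by0 : 0 < b y by apply: slope_gt0; rewrite y0 ltW.
have : b y <= e / 2.
  have /ltW := slope_increasing y0 y1 (lexx 1).
  rewrite ler_pdivrMr // divr1 => /le_trans; apply.
  by rewrite mulrC -ler_pdivlMr.
rewrite ler_norml => h1 /andP[h2 h3].
rewrite ler_norml; apply/andP; split; lra.
Qed.

(** The value is nonnegative because [b] is positive on []0, 1]]. If it were positive,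
    [b y >= (b' 0 / 2) y] near 0 would integrate to [f y >= (b' 0 / 4) y^2], against
    [f y = o(y^2)]. *)
Lemma dslope0 : b' 0 = 0.
Proof.
have key r (c : R) : 0 < r -> r <= 1 -> 0 < c ->
    (forall y, 0 < y < r -> 2 * c * y <= b y) -> False.
  move=> r0 r1 c0 H.
  have [s s0 Hs] := f_small (divr_gt0 c0 (ltr0n R 2)).
  pose u := Num.min r s.
  have u0 : 0 < u by rewrite lt_min r0.
  have ur : u <= r by rewrite ge_min lexx.
  have u1 : u <= 1 by exact: le_trans r1.
  have Hu : `|f u| <= c / 2 * u ^+ 2.
    by apply: Hs; rewrite ltW //= ge_min lexx orbT.
  have fu := ler_norm (f u).
  have u20 : 0 < u ^+ 2 by rewrite exprn_gt0.
  have cu : 0 < c * u ^+ 2 by rewrite mulr_gt0.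
  suff : 0 <= 1 * f u + - c * u ^+ 2 by move: Hu; rewrite mulrAC; lra.
  apply: quad_mono => // [|z /andP[z0 zu]]; first exact: ltW.
  by have := H z; rewrite z0 (lt_le_trans zu ur) => /(_ isT); lra.
apply/eqP; rewrite eq_le; apply/andP; split.
  rewrite leNgt; apply/negP => c0.
  have /deriv_withinP/(_ (b' 0 / 2))[|r r0 Hr] := bd0; first by rewrite divr_gt0.
  apply: (@key (Num.min r 1) (b' 0 / 4)).
  - by rewrite lt_min r0 ltr01.
  - by rewrite ge_min lexx orbT.
  - by rewrite divr_gt0.
  - move=> y; rewrite lt_min => /and3P[y0 yr y1].
    have y01 : 0 <= y <= 1 by rewrite !ltW.
    have := Hr y; rewrite /= in_itv /= y01 !subr0 slope0 subr0 gtr0_norm //.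
    move=> /(_ isT yr); rewrite ler_norml => /andP[h _].
    have -> : 2 * (b' 0 / 4) * y = b' 0 / 2 * y by field.
    by move: h; rewrite mulrAC; lra.
apply/ler_addgt0Pr => e e0.
have /deriv_withinP/(_ e e0)[r r0 Hr] := bd0.
pose y := Num.min (r / 2) 1.
have y0 : 0 < y by rewrite lt_min ltr01 divr_gt0.
have y1 : y <= 1 by rewrite ge_min lexx orbT.
have yr : y < r.
  rewrite /y gt_min; apply/orP; left.
  by rewrite ltr_pdivrMr // ltr_pMr // ltr1n.
have by0 : 0 < b y by apply: slope_gt0; rewrite y0.
have := Hr y; rewrite /= in_itv /= !subr0 slope0 subr0 gtr0_norm //.
rewrite y1 ltW // => /(_ isT yr); rewrite ler_norml => /andP[_ h].
rewrite -(pmulr_lge0 _ y0) mulrDl; lra.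
Qed.

End PositiveSlope.
End ContrastAmplifier.

(** * From contrast functions to amplifiers *)

Section ContrastDerivative.
Context {R : realType}.

Lemma itv_approach (a b x r : R) : a < b -> a <= x <= b -> 0 < r ->
  exists y, [/\ a < y < b, y != x & `|y - x| < r].
Proof.
move=> ab /andP[ax xb] r0.
pose m := (a + b) / 2.
have am : a < m by rewrite /m; lra.
have mb : m < b by rewrite /m; lra.
pose t := Num.min (r / 3) ((b - a) / 3).
have t0 : 0 < t by rewrite lt_min !divr_gt0 // subr_gt0.
have tr : t < r by rewrite /t gt_min; apply/orP; left; lra.
have tb : t <= (b - a) / 3 by rewrite /t ge_min lexx orbT.
have [xm|mx] := leP x m.
  exists (x + t); split.
  - by apply/andP; split; move: xm; rewrite /m; lra.
  - by apply/eqP; lra.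
  - by rewrite addrC addKr gtr0_norm.
exists (x - t); split.
- by apply/andP; split; move: mx; rewrite /m; lra.
- by apply/eqP; lra.
- by rewrite addrC addKr normrN gtr0_norm.
Qed.

Lemma itv_deriv_within_unique (i : interval R) a b f x l l' : a < b ->
  (forall y, a < y < b -> y \in i) -> a <= x <= b ->
  deriv_within [set` i] f x l -> deriv_within [set` i] f x l' -> l = l'.
Proof.
move=> ab sub xab; apply: deriv_within_unique => r r0.
have [y [yab yx yr]] := itv_approach ab xab r0.
by exists y; split => //; exact: sub.
Qed.

Variable g : R -> R.
Hypothesis hg : contrast g.

(** [C2_on] offers a first derivative that may change with the point at which the second one is
    taken. Uniqueness of relative derivatives on an interval identifies all of them with the one
    obtained at 0. *)
Lemma contrast_derivatives : exists g1 g2 : R -> R,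
  [/\ forall x : R, x \in `[-1, 1] -> deriv_within `[-1, 1] g x (g1 x),
      forall x : R, x \in `[-1, 1] -> deriv_within `[-1, 1] g1 x (g2 x) &
      {within `[-1, 1], continuous g2}].
Proof.
have [g2 [H g2c]] := contrast_C2 hg.
have [|g1 [g1d _]] := H 0; first by rewrite /= in_itv /=; apply/andP; split; lra.
exists g1, g2; split => // x xi; have [f1 [f1d f1x]] := H x xi.
apply: deriv_within_eqfun f1x => // y yi.
have yi' : -1 <= y <= 1 by move: yi; rewrite /= in_itv.
apply: (itv_deriv_within_unique _ _ yi' (f1d y yi) (g1d y yi)); first by lra.
by move=> z /andP[h1 h2]; rewrite in_itv /= !ltW.
Qed.

Lemma contrast_abs_derivative (g1 : R -> R) (x : R) :
  (forall x : R, x \in `[-1, 1] -> deriv_within `[-1, 1] g x (g1 x)) ->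
  x \in `[-1, 1] -> `|g1 (- x)| = `|g1 x|.
Proof.
move=> g1d xi.
have Ni (y : R) : y \in `[-1, 1] -> - y \in `[-1, 1].
  by rewrite !in_itv /= => /andP[h1 h2]; apply/andP; split; lra.
have nxi : -1 <= - x <= 1 by move: (Ni _ xi); rewrite in_itv.
have uniq : forall l, deriv_within `[-1, 1] g (- x) l -> g1 (- x) = l.
  move=> l; apply: (itv_deriv_within_unique _ _ nxi); first by lra.
    by move=> z /andP[h1 h2]; rewrite in_itv /= !ltW.
  exact/g1d/Ni.
have /deriv_withinP gx := g1d x xi.
have [ge|go] := contrast_parity hg.
  rewrite (uniq (- g1 x)) ?normrN //; apply/deriv_withinP => e /gx[r r0 Hr].
  exists r => // y yi yx; have yE : `|- y - x| = `|y - - x|.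
    by rewrite -normrN opprD !opprK.
  have := Hr (- y) (Ni _ yi); rewrite yE => /(_ yx).
  rewrite (ge y yi) (ge x xi).
  by have -> : g1 x * (- y - x) = - g1 x * (y - - x) by ring.
rewrite (uniq (g1 x)) //; apply/deriv_withinP => e /gx[r r0 Hr].
exists r => // y yi yx; have yE : `|- y - x| = `|y - - x|.
  by rewrite -normrN opprD !opprK.
have := Hr (- y) (Ni _ yi); rewrite yE => /(_ yx).
rewrite (go y yi) (go x xi) -normrN.
by have -> : - (- g y - g x - g1 x * (- y - x)) =
  g y - - g x - g1 x * (y - - x) by ring.
Qed.

Lemma contrast_sign : exists2 sg : R, sg = 1 \/ sg = -1 &
  forall x : R, x \in `]0, 1] -> exists2 l,
    deriv2_within `]0, 1] (fun y => g (Num.sqrt y)) x l & 0 < sg * l.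
Proof.
have [h|h] := contrast_convexity hg; [exists 1|exists (-1)]; auto.
  by move=> x /h[l hl l0]; exists l => //; rewrite mul1r.
by move=> x /h[l hl l0]; exists l => //; rewrite mulN1r.
Qed.

Lemma is_derive_sqr (x : R) : is_derive x 1 (fun z : R => z * z) (2 * x).
Proof.
apply: (is_derive_eq (is_deriveM (is_derive_id x 1) (is_derive_id x 1))).
by rewrite /GRing.scale /= mulr1 mulr_natl.
Qed.

Lemma nbhs_itv (i : interval R) (a b x : R) :
  (forall y, a < y < b -> y \in i) -> a < x < b -> nbhs x [set` i].
Proof.
move=> sub /andP[ax xb].
apply: (filterS (P := [set` `]a, b[])).
  by move=> y /=; rewrite in_itv /=; exact: sub.
by apply: near_in_itvoo; rewrite in_itv /= ax.
Qed.

(* With [g y = k (y^2)], [g' = 2 y k'] and [g'' = 2 k' + 4 y^2 k''], so that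
   [y g'' - g' = 4 y^3 k'']. *)
Lemma contrast_slope (g1 g2 : R -> R) (sg : R) :
  (forall x : R, x \in `[-1, 1] -> deriv_within `[-1, 1] g x (g1 x)) ->
  (forall x : R, x \in `[-1, 1] -> deriv_within `[-1, 1] g1 x (g2 x)) ->
  (forall x : R, x \in `]0, 1] -> exists2 l,
    deriv2_within `]0, 1] (fun y => g (Num.sqrt y)) x l & 0 < sg * l) ->
  forall x : R, 0 < x < 1 -> sg * g1 x < x * (sg * g2 x).
Proof.
move=> g1d g2d conv x /andP[x0 x1].
pose k y := g (Num.sqrt y).
have one : 1 \in `]0, 1 : R] by rewrite in_itv /= ltr01 lexx.
(* Again the first derivative is existential at each point; the one obtained at 1 serves everywhere
   by uniqueness. *)
have [_ [k1 [k1d _]] _] := conv 1 one.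
have k2d (t : R) : t \in `]0, 1] -> exists2 l, deriv_within `]0, 1] k1 t l & 0 < sg * l.
  move=> ti; have [l [f1 [f1d f1l]] l0] := conv t ti; exists l => //.
  apply: deriv_within_eqfun f1l => // y yi.
  have yi' : 0 <= y <= 1.
    by move: yi; rewrite /= in_itv /= => /andP[h1 h2]; rewrite ltW.
  apply: (itv_deriv_within_unique ltr01 _ yi' (f1d y yi) (k1d y yi)).
  by move=> z /andP[h1 h2]; rewrite in_itv /= h1 ltW.
have itv2 (y : R) : 0 < y < 1 -> 0 < y * y < 1.
  by move=> /andP[h1 h2]; rewrite mulr_gt0 //= -[ltRHS](mulr1 1) ltr_pM // ltW.
have nb01 (t : R) : 0 < t < 1 -> nbhs t [set` `]0, 1]].
  by apply: nbhs_itv => y /andP[h1 h2]; rewrite in_itv /= h1 ltW.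
have nb11 (t : R) : 0 < t < 1 -> nbhs t [set` `[-1, 1]].
  move=> t01; apply: (@nbhs_itv _ 0 1) => // y /andP[h1 h2].
  by rewrite in_itv /= (ltW h2) andbT (le_trans _ (ltW h1)) // lerN10.
have i11 (t : R) : 0 < t < 1 -> t \in `[-1, 1].
  by move=> /nb11 /nbhs_singleton.
have g1E (y : R) : 0 < y < 1 -> g1 y = k1 (y * y) * (2 * y).
  move=> y01; have yy := itv2 y y01.
  have hg1 : is_derive y 1 g (g1 y).
    exact: (deriv_within_is_derive (nb11 y y01) (g1d y (i11 y y01))).
  have hk : is_derive (y * y) 1 k (k1 (y * y)).
    apply: (deriv_within_is_derive (nb01 _ yy)); apply: k1d.
    by move: yy => /andP[h1 h2]; rewrite /= in_itv /= h1 ltW.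
  have hc := is_derive1_comp (g := fun z : R => z * z) hk (is_derive_sqr y).
  have hg2 : is_derive y 1 g (k1 (y * y) * (2 * y)).
    apply: near_eq_is_derive hc; near=> z.
    rewrite /k /= -expr2 sqrtr_sqr gtr0_norm //; near: z.
    by move/andP: y01 => [y0 _]; exact: lt_nbhsr.
  by rewrite -(@derive_val _ _ _ _ _ _ _ hg1) (@derive_val _ _ _ _ _ _ _ hg2).
have x01 : 0 < x < 1 by rewrite x0.
have xx := itv2 x x01.
have [|l k1l l0] := k2d (x * x).
  by move: xx => /andP[h1 h2]; rewrite in_itv /= h1 ltW.
have h1 : is_derive x 1 g1 (g2 x).
  exact: (deriv_within_is_derive (nb11 x x01) (g2d x (i11 x x01))).
have hk1 : is_derive (x * x) 1 k1 l.
  exact: (deriv_within_is_derive (nb01 _ xx) k1l).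
have hc := is_derive1_comp (g := fun z : R => z * z) hk1 (is_derive_sqr x).
have hm := is_deriveM hc (is_deriveZ 2 (is_derive_id x 1)).
have h2 := near_eq_is_derive (g := g1) _ hm.
have g2E : g2 x = k1 (x * x) * 2 + 2 * x * (l * (2 * x)).
  rewrite -(@derive_val _ _ _ _ _ _ _ h1); apply: (@derive_val _ _ _ _ _ _ _).
  apply: (is_derive_eq (h2 _)); last by rewrite /GRing.scale /= mulr1.
  near=> z; rewrite /= g1E //.
  by near: z; apply: (@near_in_itvoo R 0 1); rewrite in_itv.
rewrite g1E // g2E -subr_gt0.
have -> : x * (sg * (k1 (x * x) * 2 + 2 * x * (l * (2 * x)))) -
  sg * (k1 (x * x) * (2 * x)) = 4 * x ^+ 3 * (sg * l) by ring.
by rewrite mulr_gt0 // mulr_gt0 // exprn_gt0.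
Unshelve. all: by end_near. Qed.

(** Condition (3) says [g (sqrt t) = o(t)]; it is read at [t = y^2], where [y <= 1 / 2] keeps
    [t <= y] and inside the interval. *)
Lemma contrast_small e : 0 < e -> exists2 r, 0 < r &
  forall y, 0 <= y <= r -> `|g y| <= e * y ^+ 2.
Proof.
move=> e0; have /deriv_withinP/(_ e e0)[r r0 Hr] := contrast_deriv0 hg.
exists (Num.min (r / 2) (1 / 2)); first by rewrite lt_min !divr_gt0.
move=> y /andP[y0]; rewrite le_min => /andP[yr y1].
have yy : y ^+ 2 <= y by rewrite expr2 ler_piMr //; lra.
have y20 : 0 <= y ^+ 2 by rewrite exprn_ge0.
have := Hr (y ^+ 2); rewrite subr0 (ger0_norm y20) sqrtr0 (contrast0 hg).
rewrite mul0r !subr0 sqrtr_sqr (ger0_norm y0); apply; last by lra.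
by rewrite /= in_itv /= y20; lra.
Qed.

(** [sg] turns the concave case into the convex one. The last clause is what lets the gradient map
    descend to absolute coordinates: parity moves the argument to [[0, 1]], where [sg * g1] is
    nonnegative. *)
Lemma contrast_amplifier : exists (g1 : R -> R) (sg : R),
  [/\ forall x : R, x \in `[-1, 1] -> deriv_within `[-1, 1] g x (g1 x),
      amplifier (fun x => sg * g1 x) &
      forall x : R, x \in `[-1, 1] -> `|g1 x| = sg * g1 `|x| ].
Proof.
have [g1 [g2 [g1d g2d g2c]]] := contrast_derivatives.
have [sg sgE conv] := contrast_sign.
have sg1 : `|sg| = 1 by case: sgE => ->; rewrite ?normrN normr1.
pose b x := sg * g1 x; pose b' x := sg * g2 x; pose f x := sg * g x.
have sub01 : ([set` `[0, 1]] : set R) `<=` [set` `[-1, 1]].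
  move=> x /=; rewrite !in_itv /= => /andP[x0 ->]; rewrite andbT.
  by rewrite (le_trans _ x0) // lerN10.
have nb01 (t : R) : t \in `]0, 1[ -> nbhs t [set` `[0, 1]].
  move=> t01; apply: (@nbhs_itv _ 0 1); last by rewrite in_itv in t01.
  by move=> y /andP[h1 h2]; rewrite in_itv /= !ltW.
have in01 (t : R) : t \in `]0, 1[ -> [set` `[0, 1]] t.
  by move=> /nb01/nbhs_singleton.
have fD (x : R) : [set` `[0, 1]] x -> deriv_within `[0, 1] f x (b x).
  by move=> xi; apply/deriv_withinZ/(deriv_withinS sub01)/g1d; exact: sub01.
have bD (x : R) : [set` `[0, 1]] x -> deriv_within `[0, 1] b x (b' x).
  by move=> xi; apply/deriv_withinZ/(deriv_withinS sub01)/g2d; exact: sub01.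
have fd (x : R) : x \in `]0, 1[ -> is_derive x 1 f (b x).
  by move=> xi; exact: deriv_within_is_derive (nb01 x xi) (fD x (in01 x xi)).
have bd (x : R) : x \in `]0, 1[ -> is_derive x 1 b (b' x).
  by move=> xi; exact: deriv_within_is_derive (nb01 x xi) (bD x (in01 x xi)).
have fc := deriv_within_continuous fD; have bc := deriv_within_continuous bD.
have b'c : {within `[0, 1], continuous b'}.
  apply/subspace_continuousP => x xi; apply: cvgM; first exact: cvg_cst.
  have g2c' : {within `[0, 1], continuous g2} by exact: continuous_subspaceW g2c.
  by have /subspace_continuousP := g2c'; apply.
have f0 : f 0 = 0 by rewrite /f (contrast0 hg) mulr0.
have fs (e : R) : 0 < e -> exists2 r, 0 < r &
    forall y, 0 <= y <= r -> `|f y| <= e * y ^+ 2.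
  move=> /contrast_small[r r0 Hr]; exists r => // y yr.
  by rewrite normrM sg1 mul1r; exact: Hr.
have zero01 : [set` `[0, 1]] (0 : R) by rewrite /= in_itv /= lexx ler01.
have blt := contrast_slope g1d g2d conv.
have bpos := slope_gt0 fd fc f0 fs bd bc blt.
exists g1, sg; split => //.
  apply: (amplifier_of_derivative bd bc b'c _ _ bpos blt).
    exact: (slope0 fd fc f0 fs bd bc blt).
  exact: (dslope0 fd fc f0 fs bd bc (bD 0 zero01) blt).
have pos (x : R) : 0 <= x <= 1 -> `|g1 x| = sg * g1 x.
  move=> /andP[x0 x1]; rewrite -[LHS]mul1r -sg1 -normrM ger0_norm //.
  move: x0; rewrite le_eqVlt => /predU1P[<-|x0].
    by rewrite -/(b 0) (slope0 fd fc f0 fs bd bc blt).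
  by rewrite ltW //; apply: bpos; rewrite x0.
move=> x xi; rewrite -pos; last first.
  by rewrite normr_ge0 /= ler_norml; move: xi; rewrite in_itv.
have [x0|x0] := leP 0 x; first by rewrite (ger0_norm x0).
by rewrite (ltr0_norm x0) contrast_abs_derivative.
Qed.

End ContrastDerivative.

(** * The gradient map in absolute coordinates *)

Section EuclidTheory.
Context {R : realType} {d : nat}.
Implicit Types (u v w : 'rV[R]_d) (e : orthobasis R d).

Lemma coord_le_enorm u i : `|u 0 i| <= enorm u.
Proof.
rewrite -(@ler_pXn2r _ 2) ?nnegrE ?enorm_ge0 //.
rewrite enorm_sqr -normrX ger0_norm ?sqr_ge0 // /dot (bigD1 i) //= -expr2 lerDl.
by apply: sumr_ge0 => j _; rewrite -expr2 sqr_ge0.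
Qed.

Lemma enorm_le_sum u : enorm u <= \sum_i `|u 0 i|.
Proof.
have s0 : 0 <= \sum_i `|u 0 i| by apply: sumr_ge0.
rewrite -(@ler_pXn2r _ 2) ?nnegrE ?enorm_ge0 // enorm_sqr expr2 mulr_suml.
apply: ler_sum => i _; apply: le_trans (ler_norm _) _.
by rewrite normrM ler_wpM2l // (bigD1 i) //= lerDl sumr_ge0.
Qed.

Lemma nbhs_enormP u (P : set 'rV[R]_d) :
  nbhs u P <-> exists2 r, 0 < r & forall w, enorm (w - u) < r -> P w.
Proof.
split=> [/nbhs_ballP[r /= r0 Hr]|[r r0 Hr]].
  exists r => // w wr; apply: Hr; split => // i j /=.
  rewrite -ball_normE /= (ord1 i) distrC; apply: le_lt_trans wr.
  by have := coord_le_enorm (w - u) j; rewrite !mxE.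
(* Dividing by [d + 1] keeps the sum of [d] coordinate bounds strictly below [r], also for
   [d = 0]. *)
apply/nbhs_ballP; exists (r / d.+1%:R) => /=; first by rewrite divr_gt0 ?ltr0n.
move=> w wr; apply: Hr; apply: le_lt_trans (enorm_le_sum _) _.
apply: (@le_lt_trans _ _ (\sum_(i < d) r / d.+1%:R)).
  apply: ler_sum => i _; have := wr.2 0 i; rewrite -ball_normE /= distrC !mxE.
  by move/ltW.
rewrite sumr_const card_ord -[(_ / _) *+ d]mulr_natr mulrAC ltr_pdivrMr ?ltr0n //.
by rewrite ltr_pM2l // ltr_nat.
Qed.

Lemma is_gradientP F u v : is_gradient F u v <->
  forall eps, 0 < eps -> exists2 r, 0 < r & forall w, unit_cball w ->
    enorm (w - u) < r ->
    `|F w - F u - dot v (w - u)| <= eps * enorm (w - u).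
Proof.
rewrite /is_gradient; split => [/cvgrPdist_le H eps e0|H].
  have /nbhs_enormP[r r0 Hr] := H eps e0.
  exists r => // w bw wr; have [->|wu] := eqVneq w u.
    by rewrite !subrr dotC dot0l subrr normr0 mulr_ge0 ?enorm_ge0 ?ltW.
  have n0 : 0 < enorm (w - u) by rewrite lt_neqAle eq_sym enorm_eq0 subr_eq0 wu enorm_ge0.
  have := Hr w wr wu bw; rewrite sub0r normrN normrM normfV (gtr0_norm n0).
  by rewrite ler_pdivrMr.
apply/cvgrPdist_le => eps e0; have [r r0 Hr] := H eps e0.
apply/nbhs_enormP; exists r => // w wr wu bw.
have n0 : 0 < enorm (w - u) by rewrite lt_neqAle eq_sym enorm_eq0 subr_eq0 wu enorm_ge0.
rewrite sub0r normrN normrM normfV (gtr0_norm n0) ler_pdivrMr //.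
exact: Hr.
Qed.

Lemma enorm0 : enorm (0 : 'rV[R]_d) = 0.
Proof. by apply/eqP; rewrite enorm_eq0. Qed.

(* Moving from [u] towards a point [y] of the ball by convexity shows that
   [v - v'] is orthogonal to [y - u]; take [y = 0] and [y] along [v - v']. *)
Lemma is_gradient_unique F u v v' : unit_cball u ->
  is_gradient F u v -> is_gradient F u v' -> v = v'.
Proof.
move=> bu /is_gradientP Hv /is_gradientP Hv'; pose D := v - v'.
have orth y : unit_cball y -> dot D (y - u) = 0.
  move=> by_; apply/eqP; rewrite -normr_le0; apply/ler_addgt0Pr => eps e0.
  rewrite add0r; pose c := enorm (y - u) + 1.
  have c0 : 0 < c by rewrite ltr_wpDl ?enorm_ge0.
  have e20 : 0 < eps / 2 / c by rewrite !divr_gt0.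
  have [r r0 Hr] := Hv _ e20; have [r' r'0 Hr'] := Hv' _ e20.
  pose t := Num.min (Num.min r r' / (2 * c)) 1.
  have m0 : 0 < Num.min r r' by rewrite lt_min r0.
  have t0 : 0 < t by rewrite lt_min ltr01 divr_gt0 // mulr_gt0.
  have t1 : t <= 1 by rewrite ge_min lexx orbT.
  have tc : t * c < Num.min r r'.
    apply: (@le_lt_trans _ _ (Num.min r r' / 2)).
      by rewrite -ler_pdivlMr // -mulrA -invfM ge_min lexx.
    by rewrite ltr_pdivrMr // ltr_pMr // ltr1n.
  pose w := u + t *: (y - u).
  have wu : w - u = t *: (y - u) by rewrite /w addrC addKr.
  have nw : enorm (w - u) = t * enorm (y - u) by rewrite wu enormZ gtr0_norm.
  have bw : unit_cball w.
    rewrite /unit_cball /=; have -> : w = (1 - t) *: u + t *: y.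
      by rewrite /w scalerBr scalerBl scale1r addrA addrAC.
    apply: le_trans (enormD _ _) _; rewrite !enormZ (gtr0_norm t0).
    rewrite ger0_norm ?subr_ge0 // -[leRHS](subrK t).
    by rewrite lerD // ler_piMr ?subr_ge0 // ltW.
  have wm : enorm (w - u) < Num.min r r'.
    rewrite nw; apply: le_lt_trans tc; rewrite ler_pM2l // lerDl //.
  have wr : enorm (w - u) < r by apply: lt_le_trans wm _; rewrite ge_min lexx.
  have wr' : enorm (w - u) < r'.
    by apply: lt_le_trans wm _; rewrite ge_min lexx orbT.
  have h1 := Hr w bw wr; have h2 := Hr' w bw wr'.
  have : `|dot D (w - u)| <= eps / c * enorm (w - u).
    have -> : dot D (w - u) =
      (F w - F u - dot v' (w - u)) - (F w - F u - dot v (w - u)).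
      by rewrite /D dotDl -(scaleN1r v') dotZl; ring.
    apply: le_trans (ler_normB _ _) _.
    have -> : eps / c = eps / 2 / c + eps / 2 / c by field; exact: lt0r_neq0.
    by rewrite mulrDl lerD.
  rewrite nw wu dotZr normrM gtr0_norm // mulrCA ler_pM2l // => /le_trans; apply.
  rewrite mulrAC ler_pdivrMr // ler_pM2l // lerDl //.
have Du : dot D u = 0.
  have b0 : unit_cball (0 : 'rV[R]_d) by rewrite /unit_cball /= enorm0.
  have := orth 0 b0; rewrite sub0r -scaleN1r dotZr mulN1r => /eqP.
  by rewrite oppr_eq0 => /eqP.
apply/eqP; rewrite -subr_eq0 -/D; apply/negPn/negP => D0.
have n0 : enorm D != 0 by rewrite enorm_eq0.
have : unit_cball ((enorm D)^-1 *: D).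
  by rewrite /unit_cball /= enormZ normfV ger0_norm ?enorm_ge0 // mulVf.
move=> /orth; rewrite dotDr -scaleN1r !dotZr Du mulr0 addr0 => /eqP.
by rewrite mulf_eq0 invr_eq0 (negPf n0) dot_eq0 (negPf D0).
Qed.

(** Orthonormality is [E E^T = 1]; for a square matrix the reverse product is 1 as well, and this is
    completeness. *)
Lemma orthobasis_decomp e u : u = \sum_i dot u (e i) *: e i.
Proof.
pose E : 'M[R]_d := \matrix_(i, j) e i 0 j.
have EE : E *m E^T = 1%:M.
  apply/matrixP => i j; rewrite !mxE -(orthobasisP e).
  by apply: eq_bigr => k _; rewrite !mxE.
rewrite -[LHS](mulmx1 u) -(mulmx1C EE) mulmxA.
apply/rowP => j; rewrite mxE summxE; apply: eq_bigr => i _.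
rewrite !mxE; congr (_ * _); apply: eq_bigr => k _; by rewrite !mxE.
Qed.

Lemma parseval e u v : dot u v = \sum_i dot u (e i) * dot v (e i).
Proof.
rewrite {1}(orthobasis_decomp e u) dot_suml; apply: eq_bigr => i _.
by rewrite dotZl (dotC (e i)).
Qed.

(** The coordinates of [phi [u]] in the hidden basis: an isometric model of the quotient inside the
    nonnegative orthant. *)
Definition absc e u : 'rV[R]_d := \row_i `|dot u (e i)|.

Lemma enorm_absc e u : enorm (absc e u) = enorm u.
Proof.
congr Num.sqrt; rewrite [RHS](parseval e); apply: eq_bigr => i _.
by rewrite !mxE -!expr2 -normrX ger0_norm ?sqr_ge0.
Qed.

Lemma quot_dist_absc e (u v : sphere R d) :
  mdist (class_of_pt e u) (class_of_pt e v) = enorm (absc e u - absc e v).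
Proof.
rewrite /mdist /= /quot_dist; congr Num.sqrt; rewrite (parseval e).
apply: eq_bigr => i _; rewrite dotDl -scaleN1r dotZl !dot_phi !mxE mulN1r.
have := (class_of_ptP e (repr (class_of_pt e u)) u).1 (reprK _) i.
have := (class_of_ptP e (repr (class_of_pt e v)) v).1 (reprK _) i.
by move=> -> ->.
Qed.

Lemma dot_le_enorm e u i : `|dot u (e i)| <= enorm u.
Proof. by have := coord_le_enorm (absc e u) i; rewrite mxE normr_id enorm_absc. Qed.

End EuclidTheory.

(** Takes the minimum of finitely many thresholds. Constants that have to be large are passed to it
    as inverses. *)
Lemma fin_uniform_pos (R : realType) (I : finType) (Q : I -> R -> Prop) :
  (forall i r r', 0 < r' -> r' <= r -> Q i r -> Q i r') ->
  (forall i, exists2 r, 0 < r & Q i r) -> exists2 r, 0 < r & forall i, Q i r.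
Proof.
move=> Qle H.
have {}H i : exists r, 0 < r /\ Q i r by have [r] := H i; exists r.
have [r Hr] := choice H.
have m0 : 0 < \big[Num.min/1]_i r i.
  by elim/big_ind: _ => // [x y x0 y0|i _]; [rewrite lt_min x0 | exact: (Hr i).1].
exists (\big[Num.min/1]_i r i) => // i.
by apply: Qle m0 _ (Hr i).2; exact: bigmin_le.
Qed.

Section AmplifierStep.
Context {R : realType} {d : nat}.
Variable b : 'I_d -> R -> R.
Implicit Types x : 'rV[R]_d.

Definition amp_field x : 'rV[R]_d := \row_i b i (x 0 i).

Definition amp_step x : 'rV[R]_d :=
  if amp_field x == 0 then x else (enorm (amp_field x))^-1 *: amp_field x.

End AmplifierStep.

Section OdecoGradient.
Context {R : realType} {d m : nat}.
Variables (hmd : (m <= d)%N) (e : orthobasis R d) (g : 'I_m -> R -> R).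
Variable F : 'rV[R]_d -> R.
Hypothesis hF : odeco hmd e g F.

Lemma abscZ a u : absc e (a *: u) = `|a| *: absc e u.
Proof. by apply/rowP => i; rewrite !mxE dotZl normrM. Qed.

(** Coordinates of points of the ball stay in [[-1, 1]] and are 1-Lipschitz, so the one-variable
    expansions relative to [[-1, 1]] add up, even where a coordinate equals 1 or -1. *)
Lemma odeco_is_gradient (g1 : 'I_m -> R -> R) u : unit_cball u ->
  (forall i (x : R), x \in `[-1, 1] -> deriv_within `[-1, 1] (g i) x (g1 i x)) ->
  is_gradient F u (\sum_(i < m) g1 i (dot u (e (widen_ord hmd i)))
                     *: e (widen_ord hmd i)).
Proof.
move=> bu g1d; apply/is_gradientP => eps e0.
have in11 w i : unit_cball w -> dot w (e i) \in `[-1, 1].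
  by move=> bw; rewrite in_itv /= -ler_norml (le_trans (dot_le_enorm _ _ _)).
pose c i w := dot w (e (widen_ord hmd i)).
have em0 : 0 < eps / m.+1%:R by rewrite divr_gt0 ?ltr0n.
have [r r0 Hr] : exists2 r, 0 < r & forall i, forall y, y \in `[-1, 1] ->
    `|y - c i u| < r ->
    `|g i y - g i (c i u) - g1 i (c i u) * (y - c i u)| <=
      eps / m.+1%:R * `|y - c i u|.
  apply: fin_uniform_pos => [i r r' r0 rr' H y yi yr|i].
    by apply: H => //; exact: lt_le_trans rr'.
  exact: ((deriv_withinP _ _ _ _).1 (g1d i _ (in11 _ _ bu)) _ em0).
exists r => // w bw wr.
have cB i : c i w - c i u = c i (w - u).
  by rewrite /c dotDl -(scaleN1r u) dotZl mulN1r.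
have cle i : `|c i w - c i u| <= enorm (w - u) by rewrite cB dot_le_enorm.
rewrite (hF.2 _ bw) (hF.2 _ bu) dot_suml -!sumrB.
apply: le_trans (ler_norm_sum _ _ _) _.
apply: (@le_trans _ _ (\sum_(i < m) eps / m.+1%:R * enorm (w - u))).
  apply: ler_sum => i _; rewrite dotZl (dotC (e _)) -/(c i (w - u)) -cB.
  apply: le_trans (Hr i _ (in11 _ _ bw) (le_lt_trans (cle i) wr)) _.
  by rewrite ler_pM2l // cle.
rewrite sumr_const card_ord -[_ *+ m]mulr_natr mulrAC ler_wpM2r ?enorm_ge0 //.
by rewrite mulrAC ler_pdivrMr ?ltr0n // ler_pM2l // ler_nat.
Qed.

(** On [[0, 1]] the function [b i] is the absolute value of the derivative of [g i]; directions from
    [m] on do not enter [F] and get the zero function. Later arguments see [F] only through [b]. *)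
Lemma odeco_step : exists b : 'I_d -> R -> R,
  [/\ forall i : 'I_d, (i < m)%N -> amplifier (b i),
      forall (i : 'I_d) x, (m <= i)%N -> b i x = 0 &
      forall u : sphere R d, absc e (gradient_iter F u) = amp_step b (absc e u)].
Proof.
have H i : exists p : (R -> R) * R,
  [/\ forall x : R, x \in `[-1, 1] -> deriv_within `[-1, 1] (g i) x (p.1 x),
      amplifier (fun x => p.2 * p.1 x) &
      forall x : R, x \in `[-1, 1] -> `|p.1 x| = p.2 * p.1 `|x| ].
  by have [g1 [sg Hg]] := contrast_amplifier (hF.1 i); exists (g1, sg).
have [p Hp] := choice H.
pose b (j : 'I_d) (x : R) : R :=
  if insub (j : nat) is Some i then (p i).2 * (p i).1 x else 0.
have bE i : b (widen_ord hmd i) = fun x => (p i).2 * (p i).1 x.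
  by apply/funext => x; rewrite /b /= (valK i).
have wE (j : 'I_d) (jm : (j < m)%N) : j = widen_ord hmd (Ordinal jm).
  exact: val_inj.
have b0 (j : 'I_d) x : (m <= j)%N -> b j x = 0.
  by move=> mj; rewrite /b insubF // ltnNge mj.
exists b; split => // [j jm|u]; first by rewrite (wE j jm) bE; case: (Hp (Ordinal jm)).
have bu : unit_cball (u : 'rV[R]_d) by rewrite /unit_cball /= (eqP (enorm_sphere u)).
set v := \sum_(i < m) (p i).1 (dot u (e (widen_ord hmd i))) *: e (widen_ord hmd i).
have gv : is_gradient F u v.
  apply: (odeco_is_gradient bu (g1 := fun i => (p i).1)) => i.
  by case: (Hp i).
have gradE : gradient F u = v.
  rewrite /gradient; apply: (is_gradient_unique bu _ gv).
  by apply: (@xgetPex _ 0 [set v | is_gradient F u v]); exists v.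
have vE : absc e v = amp_field b (absc e u).
  apply/rowP => j; rewrite !mxE dot_suml.
  have [jm|mj] := ltnP j m; last first.
    rewrite b0 // big1 ?normr0 // => i _; rewrite dotZl orthobasisP.
    case: eqP => [E|_]; last by rewrite mulr0.
    by move: mj; rewrite -E /= leqNgt ltn_ord.
  rewrite (wE j jm); move: (Ordinal jm) => {jm}i0.
  rewrite bE (bigD1 i0) //= big1 ?addr0.
    rewrite dotZl orthobasisP eqxx mulr1.
    case: (Hp i0) => _ _; apply.
    by rewrite in_itv /= -ler_norml (le_trans (dot_le_enorm _ _ _)).
  move=> i ij; rewrite dotZl orthobasisP; case: eqP => [E|_]; last by rewrite mulr0.
  by move: ij; rewrite -(inj_eq val_inj); move/(congr1 val): E => /= ->; rewrite eqxx.
rewrite /amp_step -vE -enorm_eq0 enorm_absc enorm_eq0.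
rewrite /gradient_iter /= gradE; case: ifP => // _.
by rewrite abscZ ger0_norm ?enorm_absc // invr_ge0 enorm_ge0.
Qed.

Lemma same_abs_class (u v : sphere R d) :
  class_of_pt e u = class_of_pt e v <-> absc e u = absc e v.
Proof.
split => [/class_of_ptP H|H]; first by apply/rowP => i; rewrite !mxE.
by apply/class_of_ptP => i; move/rowP: H => /(_ i); rewrite !mxE.
Qed.

Lemma iter_absc b (u : sphere R d) n :
  (forall u : sphere R d, absc e (gradient_iter F u) = amp_step b (absc e u)) ->
  absc e (iter n (gradient_iter F) u) = iter n (amp_step b) (absc e u).
Proof. by move=> H; elim: n => //= n <-; rewrite H. Qed.

(** [gradient_iter_quot] chooses a new representative at every step; [absc] does not depend on the
    choice. *)
Lemma iter_quot_absc b (q : sphere_quot e) n :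
  (forall u : sphere R d, absc e (gradient_iter F u) = amp_step b (absc e u)) ->
  absc e (repr (iter n (gradient_iter_quot (e := e) F) q) : sphere R d) =
  iter n (amp_step b) (absc e (repr q : sphere R d)).
Proof.
move=> H; elim: n => //= n <-; rewrite -H; apply/same_abs_class.
by rewrite /gradient_iter_quot; exact: reprK.
Qed.

End OdecoGradient.

(** * Orbits of the coordinate map *)

Section Orthant.
Context {R : realType} {d : nat}.
Implicit Types x : 'rV[R]_d.

Definition orthant_sphere : set 'rV[R]_d :=
  [set x : 'rV[R]_d | (forall i, 0 <= x 0 i) /\ enorm x = 1].

Lemma orthant_sphere_le1 x i : orthant_sphere x -> x 0 i <= 1.
Proof. by move=> [_ <-]; apply: le_trans (ler_norm _) (coord_le_enorm _ _). Qed.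

Lemma orthant_sphere_absc (e : orthobasis R d) (u : sphere R d) :
  orthant_sphere (absc e u).
Proof.
split; first by move=> i; rewrite mxE.
by rewrite enorm_absc (eqP (enorm_sphere u)).
Qed.

Lemma orthant_sphere_sum_ge1 x : orthant_sphere x -> 1 <= \sum_i x 0 i.
Proof.
move=> [x0 x1]; rewrite -x1; apply: le_trans (enorm_le_sum _) _.
by apply: ler_sum => i _; rewrite ger0_norm.
Qed.

Lemma sum_le_card (P : pred 'I_d) (f : 'I_d -> R) t : 0 <= t ->
  (forall j, P j -> f j <= t) -> \sum_(j | P j) f j <= d%:R * t.
Proof.
move=> t0 ft; apply: (@le_trans _ _ (\sum_(j < d | P j) t)); first exact: ler_sum.
rewrite sumr_const -[leLHS]mulr_natl; apply: ler_wpM2r => //; rewrite ler_nat.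
by apply: leq_trans (max_card _) _; rewrite card_ord.
Qed.

(** On the unit sphere the coordinates sum to at least 1, so [1 - x_i] is at most the sum of the
    others, which therefore counts twice. *)
Lemma enorm_sub_vertex x i t : 0 <= t -> orthant_sphere x ->
  (forall j, j != i -> x 0 j <= t) ->
  enorm (x - \row_j (j == i)%:R) <= 2 * d%:R * t.
Proof.
move=> t0 xQ xt; have [x0 _] := xQ; have xi1 := orthant_sphere_le1 i xQ.
have st := sum_le_card t0 xt.
have s1 := orthant_sphere_sum_ge1 xQ.
apply: le_trans (enorm_le_sum _) _.
rewrite (bigD1 i) //= !mxE eqxx (eq_bigr (fun j => x 0 j)); last first.
  by move=> j /negPf ji; rewrite !mxE ji subr0 ger0_norm.
rewrite ler0_norm ?subr_le0 // opprB.
move: s1; rewrite (bigD1 i) //= => s1.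
by rewrite -mulrA; move: st s1; set s := \sum_(_ | _) _; lra.
Qed.

Lemma coord_le_sub_vertex x i j : orthant_sphere x -> j != i ->
  x 0 j <= enorm (x - \row_j (j == i)%:R).
Proof.
move=> [x0 _] /negPf ji; apply: le_trans (coord_le_enorm _ j).
by rewrite !mxE ji subr0 ler_norm.
Qed.

End Orthant.

Lemma exp2_small (R : realType) (r s : R) : 0 <= r -> 0 < s ->
  exists k, forall n, (k <= n)%N -> r / 2 ^+ n <= s.
Proof.
move=> r0 s0; exists (Num.truncn (r / s)) => n kn.
have /andP[_ /ltW h] := Num.Theory.truncn_itv (divr_ge0 r0 (ltW s0)).
rewrite ler_pdivrMr ?exprn_gt0 // mulrC -ler_pdivrMr //; apply: le_trans h _.
rewrite -natrX ler_nat; apply: leq_ltn_trans kn _; exact: ltn_expl.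
Qed.

Section AmplifierDynamics.
Context {R : realType} {d : nat}.
Variables (P : {set 'I_d}) (b : 'I_d -> R -> R).
Hypothesis bP : forall i, i \in P -> amplifier (b i).
Hypothesis bN : forall i x, i \notin P -> b i x = 0.
Implicit Types x : 'rV[R]_d.

Lemma amp_le i s t : 0 <= s -> s <= t -> t <= 1 -> b i s <= b i t.
Proof.
move=> s0 st t1; case: (boolP (i \in P)) => iP; last by rewrite !bN.
have ai := bP iP; move: s0; rewrite le_eqVlt => /predU1P[s0|s0].
  rewrite -s0 (amp0 ai); move: st; rewrite -s0 le_eqVlt => /predU1P[<-|t0].
    by rewrite (amp0 ai).
  by rewrite ltW //; apply: (amp_gt0 ai); rewrite t0.
have bs : 0 < b i s by apply: (amp_gt0 ai); rewrite s0 (le_trans st).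
have bt : 0 < b i t by apply: (amp_gt0 ai); rewrite (lt_le_trans s0 st).
have := amp_ln_ge ai s0 st t1.
have lst : ln s <= ln t by rewrite ler_ln ?posrE // (lt_le_trans s0 st).
by rewrite -(@ler_ln R) ?posrE //; lra.
Qed.

Lemma amp_ge0 i t : 0 <= t <= 1 -> 0 <= b i t.
Proof.
move=> /andP[t0 t1]; have := amp_le i (lexx 0) t0 t1.
case: (boolP (i \in P)) => iP; last by rewrite !bN.
by rewrite (amp0 (bP iP)).
Qed.

Lemma amp_field_ge x i : orthant_sphere x -> b i (x 0 i) <= enorm (amp_field b x).
Proof.
move=> xQ; apply: le_trans (ler_norm _) _.
by have := coord_le_enorm (amp_field b x) i; rewrite mxE.
Qed.

Lemma amp_field_gt0 x i : orthant_sphere x -> i \in P -> 0 < x 0 i ->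
  0 < enorm (amp_field b x).
Proof.
move=> xQ iP xi; apply: lt_le_trans (amp_field_ge i xQ).
by apply: (amp_gt0 (bP iP)); rewrite xi orthant_sphere_le1.
Qed.

Lemma amp_stepE x j : 0 < enorm (amp_field b x) ->
  amp_step b x 0 j = b j (x 0 j) / enorm (amp_field b x).
Proof. by move=> h; rewrite /amp_step -enorm_eq0 gt_eqF // !mxE mulrC. Qed.

Lemma orthant_sphere_step x : orthant_sphere x -> orthant_sphere (amp_step b x).
Proof.
move=> xQ; rewrite /amp_step; case: ifPn => // y0.
split.
  move=> i; rewrite !mxE mulr_ge0 ?invr_ge0 ?enorm_ge0 ?amp_ge0 //.
  by rewrite xQ.1 orthant_sphere_le1.
by rewrite enormZ normfV ger0_norm ?enorm_ge0 // mulVf // enorm_eq0.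
Qed.

Lemma orthant_sphere_iter x n : orthant_sphere x ->
  orthant_sphere (iter n (amp_step b) x).
Proof. by move=> xQ; elim: n => //= n; exact: orthant_sphere_step. Qed.

Lemma amp_step_gt0 x i : orthant_sphere x -> i \in P -> 0 < x 0 i ->
  0 < amp_step b x 0 i.
Proof.
move=> xQ iP xi; have N0 := amp_field_gt0 xQ iP xi.
rewrite amp_stepE // divr_gt0 //.
by apply: (amp_gt0 (bP iP)); rewrite xi orthant_sphere_le1.
Qed.

Lemma amp_iter_gt0 x i n : orthant_sphere x -> i \in P -> 0 < x 0 i ->
  0 < iter n (amp_step b) x 0 i.
Proof.
move=> xQ iP xi; elim: n => //= n IH.
by apply: amp_step_gt0 => //; exact: orthant_sphere_iter.
Qed.

Lemma amp_step_off x i j : orthant_sphere x -> i \in P -> 0 < x 0 i ->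
  j \notin P -> amp_step b x 0 j = 0.
Proof.
move=> xQ iP xi jP; rewrite amp_stepE ?(amp_field_gt0 xQ iP xi) //.
by rewrite bN // mul0r.
Qed.

Lemma amp_halving : (0 < d)%N -> exists2 r, 0 < r & forall x i j,
  orthant_sphere x -> i \in P -> d%:R^-1 <= x 0 i -> x 0 j <= r ->
  amp_step b x 0 j <= x 0 j / 2.
Proof.
move=> d0; have dr0 : 0 < d%:R^-1 :> R by rewrite invr_gt0 ltr0n.
have dr1 : d%:R^-1 <= 1 :> R by rewrite invf_le1 ?ltr0n // ler1n.
have [c c0 Hc] : exists2 c, 0 < c & forall i, i \in P -> c <= b i d%:R^-1.
  apply: fin_uniform_pos => [i r r' _ rr' H iP|i]; first exact: le_trans (H iP).
  case: (boolP (i \in P)) => iP; last by exists 1.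
  by exists (b i d%:R^-1) => //; apply: (amp_gt0 (bP iP)); rewrite dr0.
have [r r0 Hr] : exists2 r, 0 < r & forall j, forall t, 0 <= t <= r ->
    b j t <= c / 2 * t.
  apply: fin_uniform_pos => [j r r' _ rr' H t /andP[t0 tr]|j].
    by apply: H; rewrite t0 (le_trans tr).
  case: (boolP (j \in P)) => jP; last first.
    by exists 1 => // t /andP[t0 _]; rewrite bN // mulr_ge0 // divr_ge0 // ltW.
  have [r r0 H] := amp_small (bP jP) (divr_gt0 c0 (ltr0n R 2)).
  exists r => // t tr; have := H t 0 tr; rewrite lexx ltW // => /(_ isT).
  rewrite (amp0 (bP jP)) !subr0 (ger0_norm (_ : 0 <= t)); last by case/andP: tr.
  exact: le_trans (ler_norm _).
exists r => // x i j xQ iP xi xj.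
have xi0 : 0 < x 0 i by exact: lt_le_trans xi.
rewrite amp_stepE ?(amp_field_gt0 xQ iP xi0) //.
rewrite ler_pdivrMr ?(amp_field_gt0 xQ iP xi0) //.
have cN : c <= enorm (amp_field b x).
  apply: le_trans (amp_field_ge i xQ); apply: le_trans (Hc i iP) _.
  by apply: amp_le xi (orthant_sphere_le1 i xQ); exact: ltW.
apply: (@le_trans _ _ (c / 2 * x 0 j)); first by apply: Hr; rewrite xQ.1.
have -> : c / 2 * x 0 j = x 0 j / 2 * c by ring.
by rewrite ler_wpM2l // divr_ge0 // xQ.1.
Qed.

Lemma exists_large x : (0 < d)%N -> orthant_sphere x ->
  (forall i, i \notin P -> x 0 i = 0) -> exists2 i, i \in P & d%:R^-1 <= x 0 i.
Proof.
move=> d0 xQ xN.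
have [/exists_inP[i iP xi]|/exists_inPn H] :=
  boolP [exists i in P, d%:R^-1 <= x 0 i]; first by exists i.
exfalso; have := orthant_sphere_sum_ge1 xQ; rewrite leNgt => /negP; apply.
have dr0 : 0 < d%:R^-1 :> R by rewrite invr_gt0 ltr0n.
have lt i : x 0 i < d%:R^-1.
  have [iP|iP] := boolP (i \in P); last by rewrite xN.
  by rewrite ltNge H.
apply: (@lt_le_trans _ _ (\sum_(i < d) d%:R^-1)).
  by apply: ltr_sum => // ; apply/hasP; exists (Ordinal d0) => //; rewrite mem_index_enum.
by rewrite sumr_const card_ord -[_ *+ d]mulr_natr mulVf // pnatr_eq0 -lt0n.
Qed.

Lemma amp_halving_iter r x : 0 < r -> (0 < d)%N ->
  (forall x i j, orthant_sphere x -> i \in P -> d%:R^-1 <= x 0 i -> x 0 j <= r ->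
    amp_step b x 0 j <= x 0 j / 2) ->
  forall j, orthant_sphere x -> x 0 j <= r ->
  (forall n, exists2 i, i \in P & d%:R^-1 <= iter n (amp_step b) x 0 i) ->
  forall n, iter n (amp_step b) x 0 j <= x 0 j / 2 ^+ n.
Proof.
move=> r0 d0 H j xQ xj big n.
elim: n => [|n IH]; first by rewrite expr0 divr1.
have [i iP xi] := big n; have xnQ := orthant_sphere_iter n xQ.
have xn0 : iter n (amp_step b) x 0 j <= r.
  apply: le_trans IH (le_trans _ xj).
  by rewrite ler_piMr ?xQ.1 // invf_le1 ?exprn_gt0 // exprn_ege1 // ler1n.
rewrite iterS; apply: le_trans (H _ i j xnQ iP xi xn0) _.
by rewrite exprSr invfM mulrA ler_wpM2r.
Qed.

Lemma vertex_attraction : (1 < d)%N -> exists2 r, 0 < r & forall i x, i \in P ->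
  orthant_sphere x -> (forall j, j != i -> x 0 j <= r) ->
  forall n j, j != i -> iter n (amp_step b) x 0 j <= x 0 j / 2 ^+ n.
Proof.
move=> d1; have d0 : (0 < d)%N by exact: ltnW.
have [r r0 Hr] := amp_halving d0.
have dr0 : 0 < d%:R :> R by rewrite ltr0n.
(* If the other coordinates are at most [1 / (2 d)], they sum to at most [1 / 2], which leaves
   [x_i >= 1 / 2 >= 1 / d] because [d >= 2]. *)
pose s := Num.min r (2 * d%:R)^-1.
exists s; first by rewrite lt_min r0 invr_gt0 mulr_gt0.
have sr : s <= r by rewrite ge_min lexx.
have sd : s <= (2 * d%:R)^-1 by rewrite ge_min lexx orbT.
have s0 : 0 < s by rewrite lt_min r0 invr_gt0 mulr_gt0.
move=> i x iP xQ xs n.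
have big y : orthant_sphere y -> (forall j, j != i -> y 0 j <= s) ->
    d%:R^-1 <= y 0 i.
  move=> yQ ys; have s1 := orthant_sphere_sum_ge1 yQ.
  have := sum_le_card (ltW s0) ys; move: s1; rewrite (bigD1 i) //= => s1 s2.
  have h1 : d%:R * s <= 2^-1 by rewrite mulrC -ler_pdivlMr // -invfM.
  have h2 : d%:R^-1 <= 2^-1 :> R by rewrite lef_pV2 ?posrE // ler_nat.
  by move: s1 s2; set S := \sum_(_ | _) _; lra.
elim: n => [|n IH] j ji; first by rewrite expr0 divr1.
have xnQ := orthant_sphere_iter n xQ.
have xns k : k != i -> iter n (amp_step b) x 0 k <= s.
  move=> ki; apply: le_trans (IH k ki) (le_trans _ (xs k ki)).
  by rewrite ler_piMr ?xQ.1 // invf_le1 ?exprn_gt0 // exprn_ege1 // ler1n.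
rewrite iterS; apply: le_trans (Hr _ i j xnQ iP (big _ xnQ xns) _) _.
  exact: le_trans (xns j ji) sr.
by rewrite exprSr invfM mulrA ler_wpM2r // IH.
Qed.

(** A coordinate that once drops to [r] is halved at every later step, since some coordinate in [P]
    is always at least [1 / d]. [S] collects those that never drop. *)
Lemma amp_dichotomy : (0 < d)%N -> exists2 r, 0 < r & forall x, orthant_sphere x ->
  (forall i, i \in P -> 0 < x 0 i) -> (forall i, i \notin P -> x 0 i = 0) ->
  exists S : {set 'I_d}, [/\ S \subset P,
    forall n i, i \in S -> r < iter n (amp_step b) x 0 i &
    forall s, 0 < s -> exists n0, forall n, (n0 <= n)%N ->
      forall j, j \notin S -> iter n (amp_step b) x 0 j <= s].
Proof.
move=> d0; have [r r0 Hr] := amp_halving d0.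
exists r => // x xQ xP xN.
have off n j : j \notin P -> iter n (amp_step b) x 0 j = 0.
  move=> jP; elim: n => [|n IH]; first exact: xN.
  have [i iP _] := exists_large d0 xQ xN.
  rewrite iterS; apply: (amp_step_off (orthant_sphere_iter n xQ) iP _ jP).
  exact: amp_iter_gt0 (xP i iP).
have big n : exists2 i, i \in P & d%:R^-1 <= iter n (amp_step b) x 0 i.
  by apply: exists_large => //; [exact: orthant_sphere_iter | exact: off].
pose S : {set 'I_d} :=
  [set i | `[< forall n, r < iter n (amp_step b) x 0 i >]]%SET.
exists S; split.
- apply/fintype.subsetP => i; rewrite inE => /asboolP H.
  by apply/negPn/negP => iP; have := H 0; rewrite off // ltNge ltW.
- by move=> n i; rewrite inE => /asboolP.
move=> s s0.
have H j : exists k, j \notin S -> forall n, (k <= n)%N ->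
    iter n (amp_step b) x 0 j <= s.
  case: (boolP (j \in S)) => [_|]; first by exists 0%N.
  rewrite inE => /asboolPn/existsNP[k /negP]; rewrite -leNgt => xk.
  have [l Hl] := exp2_small (ltW r0) s0.
  exists (k + l)%N => _ n kn.
  have xkQ := orthant_sphere_iter k xQ.
  have -> : n = ((n - k) + k)%N by rewrite subnK // (leq_trans _ kn) // leq_addr.
  rewrite iterD; apply: le_trans (amp_halving_iter r0 d0 Hr xkQ xk _ _) _.
    by move=> p; rewrite -iterD.
  apply: le_trans (Hl (n - k)%N _); last first.
    by rewrite leq_subRL // (leq_trans _ kn) // leq_addr.
  by rewrite ler_wpM2r // invr_ge0 exprn_ge0.
have [k Hk] := choice H.
exists (\max_j k j)%N => n kn j jS; apply: Hk => //.
by apply: leq_trans kn; exact: leq_bigmax.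
Qed.

End AmplifierDynamics.

Lemma cvg_mdistP (R : realType) (T : metricType R) (q : nat -> T) (p : T) :
  (forall eps : R, 0 < eps -> exists n0, forall n, (n0 <= n)%N ->
    mdist p (q n) < eps) -> q n @[n --> \oo] --> p.
Proof.
move=> H; apply/cvg_ballP => eps e0; have [n0 Hn] := H eps e0.
by exists n0 => //= n /= /Hn; rewrite ballEmdist.
Qed.

Lemma nbhs_mdistP (R : realType) (T : metricType R) (p : T) (N : set T) :
  nbhs p N <-> exists2 r : R, 0 < r & forall q, mdist p q < r -> N q.
Proof.
split=> [/nbhs_ballP[r /= r0 H]|[r r0 H]].
  by exists r => // q pq; apply: H; rewrite ballEmdist.
by apply/nbhs_ballP; exists r => //= q; rewrite ballEmdist => /H.
Qed.

(** * Attraction to the vertices *)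

Section VertexAttractor.
Context {R : realType} {d : nat}.
Variables (e : orthobasis R d) (F : 'rV[R]_d -> R).
Variables (P : {set 'I_d}) (b : 'I_d -> R -> R).
Hypothesis bP : forall i, i \in P -> amplifier (b i).
Hypothesis bN : forall i x, i \notin P -> b i x = 0.
Hypothesis stepE : forall u : sphere R d,
  absc e (gradient_iter F u) = amp_step b (absc e u).
Hypothesis d1 : (1 < d)%N.

Lemma absc_basis i : absc e (basis_pt e i) = \row_j (j == i)%:R.
Proof.
by apply/rowP => j; rewrite !mxE orthobasisP eq_sym; case: eqP; rewrite ?normr1 ?normr0.
Qed.

Lemma mdist_vertex i (u : sphere R d) :
  mdist (class_of_pt e (basis_pt e i)) (class_of_pt e u) =
  enorm (absc e u - \row_j (j == i)%:R).
Proof. by rewrite quot_dist_absc enormB absc_basis. Qed.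

Lemma vertex_attractor i : i \in P ->
  attractor (gradient_iter_quot (e := e) F) (class_of_pt e (basis_pt e i)).
Proof.
move=> iP; pose f := gradient_iter_quot (e := e) F.
set v := class_of_pt e (basis_pt e i).
pose X (q : sphere_quot e) := absc e (repr q : sphere R d).
have XQ q : orthant_sphere (X q) by exact: orthant_sphere_absc.
have Xf n q : X (iter n f q) = iter n (amp_step b) (X q).
  exact: iter_quot_absc.
have dv q : mdist v q = enorm (X q - \row_j (j == i)%:R).
  by rewrite -[q in LHS]reprK; exact: mdist_vertex.
have [r r0 Hr] := vertex_attraction bP bN d1.
have dr0 : 0 < d%:R :> R by rewrite ltr0n ltnW.
have dist_le q t n : 0 <= t -> (forall j, j != i -> X q 0 j <= r) ->
    (forall j, j != i -> X q 0 j / 2 ^+ n <= t) ->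
    mdist v (iter n f q) <= 2 * d%:R * t.
  move=> t0 qr qt; rewrite dv; apply: enorm_sub_vertex => // j ji.
  by rewrite Xf; apply: le_trans (Hr i _ iP (XQ q) qr n j ji) (qt j ji).
have Xlt q s j : mdist v q < s -> j != i -> X q 0 j <= s.
  by move=> qs ji; rewrite ltW // (le_lt_trans _ qs) // dv coord_le_sub_vertex.
(* With the factor [2 d] of [enorm_sub_vertex], coordinates of size [s / (4 d)] mean distance at
   most [s / 2]. *)
have half (s : R) : 0 < s -> 2 * d%:R * (s / (4 * d%:R)) < s.
  move=> s0; have -> : 2 * d%:R * (s / (4 * d%:R)) = s / 2.
    by field; exact: lt0r_neq0.
  by rewrite ltr_pdivrMr // ltr_pMr // ltr1n.
have s40 (s : R) : 0 < s -> 0 < s / (4 * d%:R) by move=> s0; rewrite divr_gt0 // mulr_gt0.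
split.
(* Invariance of the vertex is the decay estimate itself, with [n = 1] and [t = 0]. *)
- apply/esym/mdist_positivity/eqP; rewrite eq_le mdist_ge0 andbT.
  have v0 j : j != i -> X v 0 j <= 0.
    move=> ji; apply: le_trans (coord_le_sub_vertex (XQ v) ji) _.
    by rewrite -dv mdistxx.
  apply: le_trans (@dist_le v 0 1 (lexx 0) _ _) _; last by rewrite mulr0.
    by move=> j ji; rewrite (le_trans (v0 j ji)) // ltW.
  by move=> j ji; rewrite pmulr_lle0 ?invr_gt0 // v0.
- move=> N /nbhs_mdistP[s s0 Ns].
  pose t := Num.min r (s / (4 * d%:R)).
  have t0 : 0 < t by rewrite lt_min r0 s40.
  exists [set q | mdist v q < t]; first by apply/nbhs_mdistP; exists t.
  move=> q /= qt n; apply: Ns; apply: le_lt_trans (half s s0).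
  apply: le_trans (@dist_le q t n (ltW t0) _ _) _.
  + by move=> j ji; apply: le_trans (Xlt q t j qt ji) _; rewrite ge_min lexx.
  + move=> j ji; apply: le_trans (Xlt q t j qt ji).
    by rewrite ler_piMr ?(XQ q).1 // invf_le1 ?exprn_gt0 // exprn_ege1 // ler1n.
  + by rewrite ler_wpM2l ?mulr_ge0 // ge_min lexx orbT.
- exists [set q | mdist v q < r]; first by apply/nbhs_mdistP; exists r.
  move=> q /= qr; apply: cvg_mdistP => s s0.
  have [k Hk] := exp2_small (ltW r0) (s40 s s0).
  exists k => n kn; apply: le_lt_trans (half s s0).
  apply: dist_le; first by rewrite ltW // s40.
    by move=> j ji; exact: Xlt qr ji.
  move=> j ji; apply: le_trans (Hk n kn).
  by rewrite ler_wpM2r ?invr_ge0 ?exprn_ge0 // (Xlt q r j qr ji).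
Qed.

Lemma cvg_vertex i (u : sphere R d) :
  (forall s, 0 < s -> exists n0, forall n, (n0 <= n)%N ->
    forall j, j != i -> iter n (amp_step b) (absc e u) 0 j <= s) ->
  class_of_pt e (iter n (gradient_iter F) u) @[n --> \oo] -->
    class_of_pt e (basis_pt e i).
Proof.
move=> H; apply: cvg_mdistP => s s0.
have dr0 : 0 < d%:R :> R by rewrite ltr0n ltnW.
have t0 : 0 < s / (4 * d%:R) by rewrite divr_gt0 // mulr_gt0.
have [n0 Hn] := H _ t0; exists n0 => n kn; rewrite mdist_vertex.
apply: (@le_lt_trans _ _ (s / 2)); last first.
  by rewrite ltr_pdivrMr // ltr_pMr // ltr1n.
have -> : s / 2 = 2 * d%:R * (s / (4 * d%:R)) by field; exact: lt0r_neq0.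
apply: enorm_sub_vertex (ltW t0) _ _; first exact: orthant_sphere_absc.
by move=> j ji; rewrite (iter_absc u n stepE); exact: Hn.
Qed.

End VertexAttractor.

(** * Oscillation of log-ratios *)

Section LogRatio.
Context {R : realType} {d : nat}.
Implicit Types (x y : 'rV[R]_d) (S : {set 'I_d}).

Lemma ln_sub_le (s t : R) : 0 < s -> 0 < t -> ln s - ln t <= (s - t) / t.
Proof.
move=> s0 t0; rewrite -ln_div ?posrE //.
have -> : s / t = 1 + (s - t) / t by field; exact: lt0r_neq0.
apply: le_ln1Dx.
have -> : (s - t) / t = s / t - 1 by field; exact: lt0r_neq0.
have : 0 < s / t by rewrite divr_gt0.
by lra.
Qed.

(** The slope of [ln] is at least 1 on []0, 1]], and at most [1 / r] above [r] in [ln_dist_le]; the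
    two lemmas pass between coordinates and logarithms. *)
Lemma dist_le_ln (s t : R) : 0 < s <= 1 -> 0 < t <= 1 ->
  `|s - t| <= `|ln s - ln t|.
Proof.
have main (u v : R) : 0 < v -> v <= u -> u <= 1 -> u - v <= ln u - ln v.
  move=> v0 vu u1; have u0 : 0 < u by exact: lt_le_trans vu.
  have h := ln_sub_le v0 u0.
  have : (v - u) / u <= v - u.
    by rewrite ler_pdivrMr // ler_niMr // subr_le0.
  by lra.
move=> /andP[s0 s1] /andP[t0 t1]; have [st|/ltW ts] := leP s t.
  rewrite distrC (distrC (ln s)) ger0_norm ?subr_ge0 // ger0_norm.
    exact: main.
  by rewrite subr_ge0 ler_ln.
rewrite ger0_norm ?subr_ge0 // ger0_norm; first exact: main.
by rewrite subr_ge0 ler_ln.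
Qed.

Lemma ln_dist_le (r s t : R) : 0 < r -> r <= s -> r <= t ->
  `|ln s - ln t| <= `|s - t| / r.
Proof.
move=> r0 rs rt; have s0 : 0 < s by exact: lt_le_trans rs.
have t0 : 0 < t by exact: lt_le_trans rt.
have main (u v : R) : r <= u -> r <= v -> ln u - ln v <= `|u - v| / r.
  move=> ru rv; have u0 : 0 < u by exact: lt_le_trans ru.
  have v0 : 0 < v by exact: lt_le_trans rv.
  apply: le_trans (ln_sub_le u0 v0) _.
  apply: (@le_trans _ _ (`|u - v| / v)).
    by rewrite ler_wpM2r ?invr_ge0 ?ler_norm // ltW.
  by rewrite ler_wpM2l // lef_pV2.
rewrite ler_norml main // andbT lerNl opprB distrC; exact: main.
Qed.

Definition log_ratio x y i : R := ln (x 0 i) - ln (y 0 i).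

Lemma log_ratio_sym x y i : log_ratio y x i = - log_ratio x y i.
Proof. by rewrite /log_ratio opprB. Qed.

(** If all log-ratios over [S] exceeded [D / r^2], then [x_i - y_i > D / r] for every [i], and
    already a single summand [(x_i - y_i) (x_i + y_i)] would exceed [D]. *)
Lemma log_ratio_small S x y k (r D : R) : 0 < r -> 0 <= D -> k \in S ->
  (forall i, i \in S -> r <= x 0 i) -> (forall i, i \in S -> r <= y 0 i) ->
  \sum_(i in S) (x 0 i ^+ 2 - y 0 i ^+ 2) <= D ->
  exists2 i, i \in S & log_ratio x y i <= D / r ^+ 2.
Proof.
move=> r0 D0 kS rx ry sD.
have [/exists_inP[i iS xi]|/exists_inPn H] :=
  boolP [exists i in S, log_ratio x y i <= D / r ^+ 2]; first by exists i.
exfalso; move: sD; rewrite leNgt => /negP; apply.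
have gt i : i \in S -> D < x 0 i ^+ 2 - y 0 i ^+ 2.
  move=> iS; have := H i iS; rewrite -ltNge => lt.
  have xi := rx i iS; have yi := ry i iS.
  have x0 : 0 < x 0 i by exact: lt_le_trans xi.
  have y0 : 0 < y 0 i by exact: lt_le_trans yi.
  have {}lt := lt_le_trans lt (ln_sub_le x0 y0).
  have Dr0 : 0 <= D / r ^+ 2 by rewrite divr_ge0 // exprn_ge0 // ltW.
  have xy : 0 < x 0 i - y 0 i.
    by have := le_lt_trans Dr0 lt; rewrite pmulr_lgt0 // invr_gt0.
  have {}lt : D / r ^+ 2 * y 0 i < x 0 i - y 0 i by rewrite -ltr_pdivlMr.
  have : D / r < x 0 i - y 0 i.
    apply: le_lt_trans lt.
    have -> : D / r = D / r ^+ 2 * r by field; exact: lt0r_neq0.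
    by rewrite ler_wpM2l.
  rewrite ltr_pdivrMr // => lt2; apply: lt_le_trans lt2 _.
  by rewrite subr_sqr ler_pM2l //; lra.
rewrite (bigD1 k) //= -[ltLHS]addr0 ltr_leD ?gt // sumr_ge0 // => i /andP[iS _].
by apply: le_trans D0 (ltW (gt i iS)).
Qed.

(** The oscillation determines log-ratios only up to a common additive constant. Nearly equal norms
    over [S] fix that constant, since some log-ratio is not far above 0 and some not far below. *)
Lemma log_ratio_pinch S x y k (r D : R) : 0 < r -> 0 <= D -> k \in S ->
  (forall i, i \in S -> r <= x 0 i) -> (forall i, i \in S -> r <= y 0 i) ->
  `|\sum_(i in S) (x 0 i ^+ 2 - y 0 i ^+ 2)| <= D ->
  (exists2 i, i \in S & log_ratio x y i <= D / r ^+ 2) /\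
  (exists2 i, i \in S & - (D / r ^+ 2) <= log_ratio x y i).
Proof.
move=> r0 D0 kS rx ry; rewrite ler_norml => /andP[h1 h2]; split.
  exact: (@log_ratio_small S x y k).
have [|i iS] := @log_ratio_small S y x k r D r0 D0 kS ry rx.
  move: h1; rewrite lerNl -sumrN (eq_bigr (fun i => y 0 i ^+ 2 - x 0 i ^+ 2)) //.
  by move=> i _; rewrite opprB.
by rewrite log_ratio_sym lerNl; exists i.
Qed.

(* If [rho i] is too negative, the index [c] serves in its place, and
   symmetrically [a] for [rho j]. *)
Lemma osc_expand S (rho sigma : 'I_d -> R) (p q eta D : R) a c :
  0 <= p -> p <= q -> 0 <= eta ->
  (forall i, i \in S -> 0 <= rho i -> p * rho i <= sigma i <= q * rho i) ->
  (forall i, i \in S -> rho i <= 0 -> q * rho i <= sigma i <= p * rho i) ->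
  a \in S -> rho a <= eta -> c \in S -> - eta <= rho c ->
  (forall i j, i \in S -> j \in S -> sigma i - sigma j <= D) ->
  forall i j, i \in S -> j \in S ->
    p * (rho i - rho j) <= D + 2 * ((q - p) * eta).
Proof.
move=> p0 pq eta0 pos neg aS ra cS rc HD i j iS jS.
have qp0 : 0 <= (q - p) * eta by rewrite mulr_ge0 // subr_ge0.
have [i' [iS' ii' si']] : exists i', [/\ i' \in S, rho i <= rho i' &
    p * rho i' - (q - p) * eta <= sigma i'].
  have low k : k \in S -> - eta <= rho k -> p * rho k - (q - p) * eta <= sigma k.
    move=> kS rk; have [r0|r0] := leP 0 (rho k).
      by have /andP[h _] := pos k kS r0; lra.
    have /andP[h _] := neg k kS (ltW r0); apply: le_trans h.
    have : (q - p) * (- eta) <= (q - p) * rho k by rewrite ler_wpM2l // subr_ge0.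
    by rewrite mulrN mulrBl; lra.
  have [h|h] := leP (- eta) (rho i); first by exists i; split => //; exact: low.
  by exists c; split => //; [exact: le_trans (ltW h) rc | exact: low].
have [j' [jS' jj' sj']] : exists j', [/\ j' \in S, rho j' <= rho j &
    sigma j' <= p * rho j' + (q - p) * eta].
  have upp k : k \in S -> rho k <= eta -> sigma k <= p * rho k + (q - p) * eta.
    move=> kS rk; have [r0|r0] := leP 0 (rho k).
      have /andP[_ h] := pos k kS r0; apply: le_trans h _.
      have : (q - p) * rho k <= (q - p) * eta by rewrite ler_wpM2l // subr_ge0.
      by rewrite mulrBl; lra.
    by have /andP[_ h] := neg k kS (ltW r0); lra.
  have [h|h] := leP (rho j) eta; first by exists j; split => //; exact: upp.
  by exists a; split => //; [exact: le_trans ra (ltW h) | exact: upp].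
have := HD i' j' iS' jS'.
have : p * (rho i - rho j) <= p * (rho i' - rho j') by rewrite ler_wpM2l // lerB.
by rewrite !mulrBr; lra.
Qed.

Lemma log_ratio_abs S (rho : 'I_d -> R) (eta D : R) a c :
  a \in S -> rho a <= eta -> c \in S -> - eta <= rho c ->
  (forall i j, i \in S -> j \in S -> rho i - rho j <= D) ->
  forall i, i \in S -> `|rho i| <= D + eta.
Proof.
move=> aS ra cS rc HD i iS; have h1 := HD i a iS aS; have h2 := HD c i cS iS.
by rewrite ler_norml; apply/andP; split; lra.
Qed.

(** Both norms are 1, so the sum over [S] is minus the sum off [S], where each term is
    [(x_j - y_j) (x_j + y_j)] with second factor at most [2 t]. *)
Lemma sum_sqr_diff S x y (t D : R) : orthant_sphere x -> orthant_sphere y ->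
  0 <= t -> 0 <= D ->
  (forall j, j \notin S -> x 0 j <= t) -> (forall j, j \notin S -> y 0 j <= t) ->
  (forall j, j \notin S -> `|x 0 j - y 0 j| <= D) ->
  `|\sum_(i in S) (x 0 i ^+ 2 - y 0 i ^+ 2)| <= d%:R * (2 * t * D).
Proof.
move=> [x0 x1] [y0 y1] t0 D0 xt yt xy.
have one (z : 'rV[R]_d) : enorm z = 1 -> \sum_i z 0 i ^+ 2 = 1.
  move=> z1; rewrite -[RHS](expr1n _ 2) -z1 enorm_sqr.
  by apply: eq_bigr => i _; rewrite expr2.
have : \sum_i (x 0 i ^+ 2 - y 0 i ^+ 2) = 0 by rewrite sumrB !one // subrr.
rewrite (bigID (mem S)) /= => /eqP; rewrite addr_eq0 => /eqP ->; rewrite normrN.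
apply: le_trans (ler_norm_sum _ _ _) _.
apply: sum_le_card; first by rewrite !mulr_ge0.
move=> j jS; rewrite subr_sqr normrM mulrC.
apply: ler_pM => //; last exact: xy.
rewrite ger0_norm ?addr_ge0 //; have := xt j jS; have := yt j jS; lra.
Qed.

End LogRatio.

(** * Expansion of the oscillation in one step *)

Section Cone.
Context {R : realType} {d : nat}.
Variables (P : {set 'I_d}) (b : 'I_d -> R -> R).
Hypothesis bP : forall i, i \in P -> amplifier (b i).
Hypothesis bN : forall i x, i \notin P -> b i x = 0.
Implicit Types (x y : 'rV[R]_d) (S : {set 'I_d}).

Lemma amp_uniform_ge r s : 0 < r -> s < 1 -> exists2 p, 1 < p & forall i, i \in P ->
  forall v u, r <= v -> v <= u -> u <= s ->
    p * (ln u - ln v) <= ln (b i u) - ln (b i v).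
Proof.
move=> r0 s1; have [c c0 Hc] : exists2 c : R, 0 < c & forall i, i \in P ->
    forall v u, r <= v -> v <= u -> u <= s ->
    (1 + c) * (ln u - ln v) <= ln (b i u) - ln (b i v).
  apply: fin_uniform_pos => [i c c' _ cc' H iP v u rv vu us|i].
    apply: le_trans (H iP v u rv vu us); rewrite ler_wpM2r //; last by lra.
    by rewrite subr_ge0 ler_ln // posrE (lt_le_trans r0) // (le_trans rv).
  case: (boolP (i \in P)) => iP; last by exists 1.
  have [p p1 Hp] := amp_ln_gt (bP iP) r0 s1.
  exists (p - 1); first by rewrite subr_gt0.
  by move=> _; rewrite addrC subrK.
by exists (1 + c) => //; rewrite ltrDl.
Qed.

Lemma amp_uniform_le r : 0 < r -> exists2 q, 0 < q & forall i, i \in P ->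
  forall v u, r <= v -> v <= u -> u <= 1 ->
    ln (b i u) - ln (b i v) <= q * (ln u - ln v).
Proof.
move=> r0; have [c c0 Hc] : exists2 c : R, 0 < c & forall i, i \in P ->
    forall v u, r <= v -> v <= u -> u <= 1 ->
    ln (b i u) - ln (b i v) <= c^-1 * (ln u - ln v).
  apply: fin_uniform_pos => [i c c' c'0 cc' H iP v u rv vu us|i].
    apply: le_trans (H iP v u rv vu us) _; rewrite ler_wpM2r //.
      by rewrite subr_ge0 ler_ln // posrE (lt_le_trans r0) // (le_trans rv).
    by rewrite lef_pV2 // posrE (lt_le_trans c'0).
  case: (boolP (i \in P)) => iP; last by exists 1.
  have [q q0 Hq] := amp_ln_le (bP iP) r0.
  exists q^-1; first by rewrite invr_gt0.
  by move=> _; rewrite invrK.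
by exists c^-1 => //; rewrite invr_gt0.
Qed.

Lemma amp_uniform_lip : exists2 K, 0 < K & forall i u v,
  0 <= u <= 1 -> 0 <= v <= 1 -> `|b i u - b i v| <= K * `|u - v|.
Proof.
have [c c0 Hc] : exists2 c : R, 0 < c & forall i u v,
    0 <= u <= 1 -> 0 <= v <= 1 -> `|b i u - b i v| <= c^-1 * `|u - v|.
  apply: fin_uniform_pos => [i c c' c'0 cc' H u v hu hv|i].
    apply: le_trans (H u v hu hv) _; rewrite ler_wpM2r //.
    by rewrite lef_pV2 // posrE (lt_le_trans c'0).
  case: (boolP (i \in P)) => iP; last first.
    by exists 1 => // u v _ _; rewrite !bN // subrr normr0 mulr_ge0.
  have [K K0 HK] := amp_lip (bP iP).
  by exists K^-1; rewrite ?invr_gt0 // => u v; rewrite invrK; exact: HK.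
by exists c^-1 => //; rewrite invr_gt0.
Qed.

Lemma amp_uniform_small eps : 0 < eps -> exists2 t, 0 < t & forall i u v,
  0 <= u <= t -> 0 <= v <= t -> `|b i u - b i v| <= eps * `|u - v|.
Proof.
move=> e0; apply: fin_uniform_pos => [i c c' c'0 cc' H u v /andP[u0 uc] /andP[v0 vc]|i].
  by apply: H; rewrite ?u0 ?v0 (le_trans _ cc').
case: (boolP (i \in P)) => iP; last first.
  by exists 1 => // u v _ _; rewrite !bN // subrr normr0 mulr_ge0 // ltW.
exact: amp_small (bP iP) eps e0.
Qed.

Lemma amp_at0 i : b i 0 = 0.
Proof. by case: (boolP (i \in P)) => iP; [exact: amp0 (bP iP) | exact: bN]. Qed.

(** The sign of the log-ratio tells which coordinate is the larger one; exchanging them exchanges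
    the roles of [p] and [q]. *)
Lemma amp_slopes i x y (p q r s : R) : 0 < r -> r <= x 0 i <= s -> r <= y 0 i <= s ->
  (forall v u, r <= v -> v <= u -> u <= s ->
    p * (ln u - ln v) <= ln (b i u) - ln (b i v)) ->
  (forall v u, r <= v -> v <= u -> u <= s ->
    ln (b i u) - ln (b i v) <= q * (ln u - ln v)) ->
  let sigma := ln (b i (x 0 i)) - ln (b i (y 0 i)) in
  (0 <= log_ratio x y i ->
     p * log_ratio x y i <= sigma <= q * log_ratio x y i) /\
  (log_ratio x y i <= 0 ->
     q * log_ratio x y i <= sigma <= p * log_ratio x y i).
Proof.
move=> r0 /andP[rx xs] /andP[ry ys] Hp Hq sigma.
have x0 : 0 < x 0 i by exact: lt_le_trans rx.
have y0 : 0 < y 0 i by exact: lt_le_trans ry.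
rewrite /log_ratio; split; rewrite ?subr_ge0 ?subr_le0 ler_ln // => h.
  by rewrite Hp // Hq.
have h1 := Hp _ _ rx h ys; have h2 := Hq _ _ rx h ys.
by rewrite /sigma; apply/andP; split; move: h1 h2; rewrite !mulrBr; lra.
Qed.

(** The normalizing factors of [x] and [y] cancel in the difference. *)
Lemma log_ratio_step x y i j : orthant_sphere x -> orthant_sphere y ->
  i \in P -> j \in P -> 0 < x 0 i -> 0 < y 0 i -> 0 < x 0 j -> 0 < y 0 j ->
  log_ratio (amp_step b x) (amp_step b y) i -
    log_ratio (amp_step b x) (amp_step b y) j =
  (ln (b i (x 0 i)) - ln (b i (y 0 i))) - (ln (b j (x 0 j)) - ln (b j (y 0 j))).
Proof.
move=> xQ yQ iP jP xi yi xj yj.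
have Nx := amp_field_gt0 bP xQ iP xi; have Ny := amp_field_gt0 bP yQ iP yi.
have pos k (z : 'rV[R]_d) : orthant_sphere z -> k \in P -> 0 < z 0 k ->
    0 < b k (z 0 k).
  by move=> zQ kP zk; apply: (amp_gt0 (bP kP)); rewrite zk orthant_sphere_le1.
rewrite /log_ratio !amp_stepE // !ln_div ?posrE ?pos //; ring.
Qed.

Lemma enorm_field_dist x y (K D : R) :
  orthant_sphere x -> orthant_sphere y -> 0 <= K -> 0 <= D ->
  (forall i u v, 0 <= u <= 1 -> 0 <= v <= 1 -> `|b i u - b i v| <= K * `|u - v|) ->
  (forall i, `|x 0 i - y 0 i| <= D) ->
  `|enorm (amp_field b x) - enorm (amp_field b y)| <= d%:R * (K * D).
Proof.
move=> xQ yQ K0 D0 HK xy.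
have KD : 0 <= K * D by rewrite mulr_ge0.
have half (z w : 'rV[R]_d) : orthant_sphere z -> orthant_sphere w ->
    (forall i, `|z 0 i - w 0 i| <= D) ->
    enorm (amp_field b z) - enorm (amp_field b w) <= d%:R * (K * D).
  move=> zQ wQ zw.
  have := enormD (amp_field b z - amp_field b w) (amp_field b w).
  rewrite subrK -lerBlDr => /le_trans; apply.
  apply: le_trans (enorm_le_sum _) _; apply: sum_le_card => // i _.
  rewrite !mxE; apply: le_trans (HK i _ _ _ _) _.
  - by rewrite zQ.1 orthant_sphere_le1.
  - by rewrite wQ.1 orthant_sphere_le1.
  - by rewrite ler_wpM2l.
rewrite ler_norml half // andbT lerNl opprB half // => i; rewrite distrC; exact: xy.
Qed.

Lemma amp_uniform_pos r : 0 < r -> r <= 1 -> exists2 c, 0 < c &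
  forall i, i \in P -> c <= b i r.
Proof.
move=> r0 r1; apply: fin_uniform_pos => [i c c' _ cc' H iP|i].
  exact: le_trans (H iP).
case: (boolP (i \in P)) => iP; last by exists 1.
by exists (b i r) => //; apply: (amp_gt0 (bP iP)); rewrite r0.
Qed.

(** A second coordinate above [r] leaves [x_i^2 <= 1 - r^2 <= (1 - r^2 / 2)^2]. This is how two
    elements of [S] provide the distance from 1 that [amp_ln_gt] asks for. *)
Lemma two_large_le (r : R) x i j : orthant_sphere x -> 0 < r -> r <= x 0 j ->
  i != j -> x 0 i <= 1 - r ^+ 2 / 2.
Proof.
move=> xQ r0 rj ij; have [x0 x1] := xQ.
have r1 : r <= 1 by apply: le_trans rj (orthant_sphere_le1 j xQ).
have s1 : x 0 i ^+ 2 + x 0 j ^+ 2 <= 1.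
  rewrite -[leRHS](expr1n _ 2) -x1 enorm_sqr /dot (bigD1 i) //= (bigD1 j) 1?eq_sym //=.
  by rewrite -!expr2 addrA lerDl sumr_ge0 // => k _; rewrite -expr2 sqr_ge0.
have r21 : r ^+ 2 <= 1 by rewrite expr2 -[leRHS](mulr1 1) ler_pM // ltW.
have rx : r ^+ 2 <= x 0 j ^+ 2 by rewrite lerXn2r ?nnegrE // ltW.
rewrite -(@ler_pXn2r _ 2) ?nnegrE //; last by lra.
have h0 := sqr_ge0 (r ^+ 2 / 2).
by rewrite sqrrB expr1n; lra.
Qed.

(* The log-ratios over [S] spread by a factor [p > 1], while the small
   coordinates off [S] contract; the norm discrepancy [eta] caused by the
   coordinates off [S] is a small multiple of [L]. *)
Lemma cone_step S (r : R) i0 i1 : S \subset P -> 0 < r -> r <= 1 ->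
  i0 \in S -> i1 \in S -> i0 != i1 ->
  exists th t, [/\ 1 < th, 0 < t & forall x y L,
    orthant_sphere x -> orthant_sphere y ->
    (forall i, i \in S -> r <= x 0 i) -> (forall i, i \in S -> r <= y 0 i) ->
    (forall j, j \notin S -> x 0 j <= t) -> (forall j, j \notin S -> y 0 j <= t) ->
    0 < L ->
    (forall i j, i \in S -> j \in S -> log_ratio x y i - log_ratio x y j <= L) ->
    (forall j, j \notin S -> `|x 0 j - y 0 j| <= L) ->
    (exists i j, [/\ i \in S, j \in S & L <= log_ratio x y i - log_ratio x y j]) ->
    (exists i j, [/\ i \in S, j \in S & th * L <=
       log_ratio (amp_step b x) (amp_step b y) i
       - log_ratio (amp_step b x) (amp_step b y) j]) /\
    (forall j, j \notin S -> `|amp_step b x 0 j - amp_step b y 0 j| <= L)].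
Proof.
move=> SP r0 r1 i0S i1S i01.
have SiP i : i \in S -> i \in P by exact: (fintype.subsetP SP).
pose s := 1 - r ^+ 2 / 2.
have r20 : 0 < r ^+ 2 by rewrite exprn_gt0.
have s1 : s < 1 by rewrite /s; lra.
have [p p1 Hp] := amp_uniform_ge r0 s1.
have [q' q'0 Hq'] := amp_uniform_le r0.
pose q := q' + p.
have pq : p <= q by rewrite /q; lra.
have [c c0 Hc] := amp_uniform_pos r0 r1.
have [K K0 HK] := amp_uniform_lip.
have d0 : (0 < d)%N by exact: leq_ltn_trans (leq0n _) (ltn_ord i0).
have dr0 : 0 < d%:R :> R by rewrite ltr0n.
(* Off [S], the change of the numerator costs at most [eps * L / c] and the change of the norm at
   most [eps * (d * 2 K L) / c^2]; with this [eps] the two add up to [L]. *)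
pose eps := (c^-1 + d%:R * (K * 2) / (c * c))^-1.
have A0 : 0 < c^-1 + d%:R * (K * 2) / (c * c).
  by rewrite addr_gt0 ?invr_gt0 // divr_gt0 ?mulr_gt0.
have e0 : 0 < eps by rewrite invr_gt0.
have [t1 t10 Ht1] := amp_uniform_small e0.
(* In this order: [t1] makes [b] an [eps]-contraction off [S], [1] bounds the values of [b] there by
   [eps], the third term gives [eta <= L], the last one [2 (q - p) eta <= (p - 1) / 4 * L]. *)
pose t := Num.min (Num.min t1 1) (Num.min (r ^+ 2 / (2 * d%:R))
  ((p - 1) / 8 * (r ^+ 2 / (2 * d%:R)) / (q - p + 1))).
have rd0 : 0 < r ^+ 2 / (2 * d%:R) by rewrite divr_gt0 // mulr_gt0.
have qp0 : 0 < q - p + 1 by lra.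
have t0 : 0 < t.
  by rewrite !lt_min t10 ltr01 rd0 /= !(mulr_gt0, divr_gt0, invr_gt0) //; lra.
have tt1 : t <= t1 by rewrite /t !ge_min lexx.
have t_1 : t <= 1 by rewrite /t !ge_min lexx orbT.
have tr : t <= r ^+ 2 / (2 * d%:R) by rewrite /t !ge_min lexx !orbT.
have tp : t <= (p - 1) / 8 * (r ^+ 2 / (2 * d%:R)) / (q - p + 1).
  by rewrite /t !ge_min lexx !orbT.
(* Growth by less than [(1 + p) / 2] would contradict [osc_expand]: the missing [(p - 1) / 2 * L]
   exceeds the error [(p - 1) / 4 * L]. *)
exists ((1 + p) / 2), t; split => //; first by lra.
move=> x y L xQ yQ rx ry xt yt L0 osc off [i [j [iS jS Lij]]].
pose eta := d%:R * (2 * t * L) / r ^+ 2.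
have Dl0 : 0 <= d%:R * (2 * t * L) by rewrite !mulr_ge0 // ltW.
have eta0 : 0 <= eta by rewrite divr_ge0 // ltW.
have etaE : eta = t / (r ^+ 2 / (2 * d%:R)) * L.
  by rewrite /eta; field; rewrite !lt0r_neq0.
have etaL : eta <= L.
  by rewrite etaE; apply: ler_piMl; [exact: ltW | rewrite ler_pdivrMr // mul1r].
have etap : 2 * ((q - p) * eta) <= (p - 1) / 4 * L.
  have h : t / (r ^+ 2 / (2 * d%:R)) * (q - p + 1) <= (p - 1) / 8.
    by rewrite -ler_pdivlMr // ler_pdivrMr // mulrAC.
  have h2 : (q - p) * eta <= eta * (q - p + 1) by rewrite mulrDr mulr1 mulrC lerDl.
  have h3 : eta * (q - p + 1) <= (p - 1) / 8 * L.
    by rewrite etaE mulrAC ler_pM2r.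
  by lra.
have [[a aS ra] [k kS rk]] := log_ratio_pinch r0 Dl0 iS rx ry
  (sum_sqr_diff xQ yQ (ltW t0) (ltW L0) xt yt off).
have xs k' (z : 'rV[R]_d) : orthant_sphere z -> (forall i, i \in S -> r <= z 0 i) ->
    k' \in S -> r <= z 0 k' <= s.
  move=> zQ rz kS'; rewrite rz //=.
  have [->|ki0] := eqVneq k' i0; first by apply: (two_large_le zQ r0 (rz _ i1S)).
  exact: (two_large_le zQ r0 (rz _ i0S)).
have slope k' (kS' : k' \in S) := @amp_slopes k' x y p q r s r0 (xs k' x xQ rx kS')
  (xs k' y yQ ry kS') (Hp k' (SiP _ kS')).
have Hq k' : k' \in S -> forall v u, r <= v -> v <= u -> u <= s ->
    ln (b k' u) - ln (b k' v) <= q * (ln u - ln v).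
  move=> kS' v u rv vu us; apply: le_trans (Hq' k' (SiP _ kS') v u rv vu _) _.
    exact: le_trans us (ltW s1).
  rewrite ler_wpM2r //; last by rewrite /q; lra.
  by rewrite subr_ge0 ler_ln // posrE (lt_le_trans r0) // (le_trans rv).
pose sigma k' := ln (b k' (x 0 k')) - ln (b k' (y 0 k')).
have sE k1 k2 : k1 \in S -> k2 \in S ->
    log_ratio (amp_step b x) (amp_step b y) k1 -
    log_ratio (amp_step b x) (amp_step b y) k2 = sigma k1 - sigma k2.
  by move=> k1S k2S; apply: log_ratio_step; rewrite ?SiP // (lt_le_trans r0) ?rx ?ry.
split.
  apply: contrapT => Hno.
  have := @osc_expand R d S (log_ratio x y) sigma p q eta (((1 + p) / 2) * L) a k
    _ pq eta0 _ _ aS ra kS rk _ i j iS jS.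
  have p_0 : 0 <= p by lra.
  have Hs1 k' : k' \in S -> 0 <= log_ratio x y k' ->
      p * log_ratio x y k' <= sigma k' <= q * log_ratio x y k'.
    by move=> kS'; exact: (slope k' kS' (Hq k' kS')).1.
  have Hs2 k' : k' \in S -> log_ratio x y k' <= 0 ->
      q * log_ratio x y k' <= sigma k' <= p * log_ratio x y k'.
    by move=> kS'; exact: (slope k' kS' (Hq k' kS')).2.
  have HD k1 k2 : k1 \in S -> k2 \in S -> sigma k1 - sigma k2 <= (1 + p) / 2 * L.
    move=> k1S k2S; rewrite -sE // leNgt; apply/negP => h; apply: Hno.
    by exists k1, k2; split => //; exact: ltW.
  move=> /(_ p_0 Hs1 Hs2 HD) h.
  have h1 : p * L <= p * (log_ratio x y i - log_ratio x y j) by rewrite ler_wpM2l.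
  have h2 : 0 < (p - 1) * L by rewrite mulr_gt0 // subr_gt0.
  by move: h h1 h2 etap; lra.
move=> l lS.
have Nge (z : 'rV[R]_d) : orthant_sphere z -> (forall i, i \in S -> r <= z 0 i) ->
    c <= enorm (amp_field b z).
  move=> zQ rz; apply: le_trans (amp_field_ge b i0 zQ).
  apply: le_trans (Hc i0 (SiP _ i0S)) _.
  by apply: (amp_le bP bN _ (ltW r0) (rz _ i0S)); exact: orthant_sphere_le1.
have Nx := Nge x xQ rx; have Ny := Nge y yQ ry.
have Nx0 : 0 < enorm (amp_field b x) by exact: lt_le_trans Nx.
have Ny0 : 0 < enorm (amp_field b y) by exact: lt_le_trans Ny.
(* Over [S] the log-ratios are at most [L + eta <= 2 L] in absolute value. *)
have close k' : `|x 0 k' - y 0 k'| <= 2 * L.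
  have [kS'|kS'] := boolP (k' \in S); last by apply: le_trans (off k' kS') _; lra.
  apply: le_trans (dist_le_ln _ _) _.
  - by rewrite (lt_le_trans r0) ?rx // orthant_sphere_le1.
  - by rewrite (lt_le_trans r0) ?ry // orthant_sphere_le1.
  - by apply: le_trans (log_ratio_abs aS ra kS rk osc kS') _; lra.
have Ndist := enorm_field_dist xQ yQ (ltW K0) (mulr_ge0 (ler0n R 2) (ltW L0)) HK close.
have xl : 0 <= x 0 l <= t1 by rewrite xQ.1 (le_trans (xt l lS)).
have yl : 0 <= y 0 l <= t1 by rewrite yQ.1 (le_trans (yt l lS)).
have bdiff : `|b l (x 0 l) - b l (y 0 l)| <= eps * L.
  by apply: le_trans (Ht1 l _ _ xl yl) _; rewrite ler_wpM2l ?off // ltW.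
have byl : `|b l (y 0 l)| <= eps.
  have := Ht1 l _ 0 yl; rewrite lexx ltW // => /(_ isT); rewrite amp_at0 !subr0.
  move=> /le_trans; apply; apply: ler_piMr; first exact: ltW.
  rewrite ger0_norm; last exact: yQ.1.
  exact: le_trans (yt l lS) t_1.
rewrite !amp_stepE //.
set Mx := enorm (amp_field b x) in Nx Nx0 Ndist *.
set My := enorm (amp_field b y) in Ny Ny0 Ndist *.
have -> : b l (x 0 l) / Mx - b l (y 0 l) / My =
  (b l (x 0 l) - b l (y 0 l)) / Mx - b l (y 0 l) * ((Mx - My) / (Mx * My)).
  by field; rewrite !lt0r_neq0.
apply: le_trans (ler_normB _ _) _.
have T1 : `|(b l (x 0 l) - b l (y 0 l)) / Mx| <= eps * L / c.
  rewrite normrM normfV (gtr0_norm Nx0); apply: ler_pM => //.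
    by rewrite invr_ge0 ltW.
  by rewrite lef_pV2 ?posrE.
have T2 : `|b l (y 0 l) * ((Mx - My) / (Mx * My))| <=
    eps * (d%:R * (K * (2 * L)) / (c * c)).
  have MM : 0 < Mx * My by rewrite mulr_gt0.
  rewrite normrM; apply: ler_pM => //; rewrite normrM normfV (gtr0_norm MM).
  apply: ler_pM => //; first by rewrite invr_ge0 ltW.
  rewrite lef_pV2 ?posrE ?mulr_gt0 //.
  by apply: ler_pM => //; exact: ltW.
apply: le_trans (lerD T1 T2) _.
have -> : eps * L / c + eps * (d%:R * (K * (2 * L)) / (c * c)) =
  eps * (c^-1 + d%:R * (K * 2) / (c * c)) * L by ring.
by rewrite /eps mulVf ?mul1r // lt0r_neq0.
Qed.

End Cone.

Lemma expr_unbounded (R : realType) (th L B : R) : 1 < th -> 0 < L ->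
  exists n, B < th ^+ n * L.
Proof.
move=> th1 L0; have bern n : 1 + n%:R * (th - 1) <= th ^+ n.
  elim: n => [|n IH]; first by rewrite mul0r addr0 expr0.
  rewrite exprS; have h : th * (1 + n%:R * (th - 1)) <= th * th ^+ n.
    by rewrite ler_wpM2l //; lra.
  apply: le_trans h; rewrite -natr1 -subr_ge0.
  have -> : th * (1 + n%:R * (th - 1)) - (1 + (n%:R + 1) * (th - 1)) =
    n%:R * (th - 1) ^+ 2 by ring.
  by rewrite mulr_ge0 // sqr_ge0.
have tL : 0 < (th - 1) * L by rewrite mulr_gt0 // subr_gt0.
exists (Num.truncn (`|B| / ((th - 1) * L))).+1; set n := Num.truncn _.
have /andP[_] := Num.Theory.truncn_itv (divr_ge0 (normr_ge0 B) (ltW tL)).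
rewrite -/n ltr_pdivrMr // => h; apply: le_lt_trans (ler_norm B) _.
apply: lt_le_trans h _; rewrite mulrA ler_wpM2r //; first exact: ltW.
by apply: le_trans (bern n.+1); rewrite lerDr.
Qed.

(** * Lipschitz dependence on the coordinates off [S] *)

Section Fiber.
Context {R : realType} {d : nat}.
Variables (P : {set 'I_d}) (b : 'I_d -> R -> R).
Hypothesis bP : forall i, i \in P -> amplifier (b i).
Hypothesis bN : forall i x, i \notin P -> b i x = 0.
Implicit Types (x y : 'rV[R]_d) (S : {set 'I_d}).

Lemma exists_max_gap S (f : 'I_d -> R) k : k \in S -> exists i j,
  [/\ i \in S, j \in S &
      forall i' j', i' \in S -> j' \in S -> f i' - f j' <= f i - f j].
Proof.
move=> kS; have [i iS Hi] := @Order.TotalTheory.arg_maxP _ _ _ k (mem S) f kS.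
have [j jS Hj] := @Order.TotalTheory.arg_minP _ _ _ k (mem S) f kS.
by exists i, j; split => // i' j' i'S j'S; apply: lerB; [exact: Hi | exact: Hj].
Qed.

Lemma cone_graph S (r : R) i0 i1 : S \subset P -> 0 < r -> r <= 1 ->
  i0 \in S -> i1 \in S -> i0 != i1 ->
  exists2 t, 0 < t & forall x y, orthant_sphere x -> orthant_sphere y ->
    (forall n i, i \in S -> r <= iter n (amp_step b) x 0 i) ->
    (forall n i, i \in S -> r <= iter n (amp_step b) y 0 i) ->
    (forall n j, j \notin S -> iter n (amp_step b) x 0 j <= t) ->
    (forall n j, j \notin S -> iter n (amp_step b) y 0 j <= t) ->
    forall D, 0 <= D -> (forall j, j \notin S -> `|x 0 j - y 0 j| <= D) ->
    forall i j, i \in S -> j \in S -> log_ratio x y i - log_ratio x y j <= D.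
Proof.
move=> SP r0 r1 i0S i1S i01.
have [th [t [th1 t0 Hstep]]] := cone_step bP bN SP r0 r1 i0S i1S i01.
exists t => // x y xQ yQ rx ry xt yt D D0 off i j iS jS.
rewrite leNgt; apply/negP => Lgt.
pose L := log_ratio x y i - log_ratio x y j.
have L0 : 0 < L by exact: le_lt_trans Lgt.
pose X n := iter n (amp_step b) x; pose Y n := iter n (amp_step b) y.
have grow n : exists k l, [/\ k \in S, l \in S,
    th ^+ n * L <= log_ratio (X n) (Y n) k - log_ratio (X n) (Y n) l &
    forall a, a \notin S -> `|X n 0 a - Y n 0 a| <=
      log_ratio (X n) (Y n) k - log_ratio (X n) (Y n) l].
  elim: n => [|n [k [l [kS lS Lkl offn]]]].
    exists i, j; split => //; first by rewrite expr0 mul1r.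
    by move=> a aS; apply: le_trans (off a aS) (ltW Lgt).
  (* [cone_step] wants [L] to be the full oscillation, so a maximal pair is chosen anew at each
     time. *)
  have [k' [l' [k'S l'S max]]] := exists_max_gap (log_ratio (X n) (Y n)) kS.
  set M := log_ratio (X n) (Y n) k' - log_ratio (X n) (Y n) l'.
  have XQ := orthant_sphere_iter bP bN n xQ.
  have YQ := orthant_sphere_iter bP bN n yQ.
  have LM : th ^+ n * L <= M by apply: le_trans Lkl (max _ _ kS lS).
  have M0 : 0 < M.
    by apply: lt_le_trans LM; rewrite mulr_gt0 // exprn_gt0 // (lt_trans ltr01).
  have [||[a [c [aS cS thM]]] offS] :=
    Hstep (X n) (Y n) M XQ YQ (rx n) (ry n) (xt n) (yt n) M0 max.
  - by move=> a aS; apply: le_trans (offn a aS) (max _ _ kS lS).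
  - by exists k', l'.
  exists a, c; split => //.
    apply: le_trans thM; rewrite exprS -mulrA ler_wpM2l //.
    by rewrite ltW // (lt_trans ltr01).
  move=> a' a'S; apply: le_trans (offS a' a'S) (le_trans _ thM).
  by rewrite ler_peMl // ltW.
(* Coordinates over [S] stay in [[r, 1]], so each log-ratio is at most [- ln r] in absolute value,
   and the oscillation at most twice that. *)
have [n] := expr_unbounded (- ln r - ln r) th1 L0.
have [k [l [kS lS Lkl _]]] := grow n.
rewrite ltNge => /negP; apply; apply: le_trans Lkl _.
have bnd (z : 'rV[R]_d) c : orthant_sphere z -> r <= z 0 c -> ln r <= ln (z 0 c) <= 0.
  move=> zQ rz; rewrite ler_ln ?posrE // ?rz ?(lt_le_trans r0) //=.
  by apply: ln_le0; exact: orthant_sphere_le1.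
have XQ := orthant_sphere_iter bP bN n xQ.
have YQ := orthant_sphere_iter bP bN n yQ.
have /andP[x1 x2] := bnd _ k XQ (rx n k kS).
have /andP[x3 x4] := bnd _ l XQ (rx n l lS).
have /andP[y1 y2] := bnd _ k YQ (ry n k kS).
have /andP[y3 y4] := bnd _ l YQ (ry n l lS).
by move: x1 x2 x3 x4 y1 y2 y3 y4; rewrite /log_ratio /X /Y; lra.
Qed.

(* [eta] is the price of [x] and [y] not having equal norm over [P]; it
   vanishes after the first step. *)
Lemma log_ratio_pullback x y (r q t D E : R) : 0 < r -> 1 <= q -> 0 <= t -> 0 <= D ->
  (forall i, i \in P -> forall v u, r <= v -> v <= u -> u <= 1 ->
    ln (b i u) - ln (b i v) <= q * (ln u - ln v)) ->
  orthant_sphere x -> orthant_sphere y ->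
  (forall i, i \in P -> r <= x 0 i) -> (forall i, i \in P -> r <= y 0 i) ->
  (forall j, j \notin P -> x 0 j <= t) -> (forall j, j \notin P -> y 0 j <= t) ->
  (forall j, j \notin P -> `|x 0 j - y 0 j| <= D) ->
  (forall i j, i \in P -> j \in P ->
    log_ratio (amp_step b x) (amp_step b y) i -
    log_ratio (amp_step b x) (amp_step b y) j <= E) ->
  let eta := d%:R * (2 * t * D) / r ^+ 2 in
  (forall i j, i \in P -> j \in P ->
    log_ratio x y i - log_ratio x y j <= E + 2 * ((q - 1) * eta)) /\
  (forall i, i \in P -> `|log_ratio x y i| <= E + 2 * ((q - 1) * eta) + eta).
Proof.
move=> r0 q1 t0 D0 Hq xQ yQ rx ry xt yt off HE eta.
have Dl0 : 0 <= d%:R * (2 * t * D) by rewrite !mulr_ge0.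
have eta0 : 0 <= eta by rewrite divr_ge0 // exprn_ge0 // ltW.
have pinch k : k \in P -> _ := fun kP => log_ratio_pinch r0 Dl0 kP rx ry
  (sum_sqr_diff xQ yQ t0 D0 xt yt off).
pose sigma k := ln (b k (x 0 k)) - ln (b k (y 0 k)).
have slope k (kP : k \in P) := @amp_slopes _ _ b k x y 1 q r 1 r0.
have rng k (z : 'rV[R]_d) : orthant_sphere z -> (forall i, i \in P -> r <= z 0 i) ->
    k \in P -> r <= z 0 k <= 1.
  by move=> zQ rz kP; rewrite rz //= orthant_sphere_le1.
have Hp k : k \in P -> forall v u, r <= v -> v <= u -> u <= 1 ->
    1 * (ln u - ln v) <= ln (b k u) - ln (b k v).
  move=> kP v u rv vu u1; rewrite mul1r.
  by apply: (amp_ln_ge (bP kP)) => //; exact: lt_le_trans rv.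
have Hs1 k : k \in P -> 0 <= log_ratio x y k ->
    1 * log_ratio x y k <= sigma k <= q * log_ratio x y k.
  move=> kP; exact: (slope k kP (rng k x xQ rx kP) (rng k y yQ ry kP)
    (Hp k kP) (Hq k kP)).1.
have Hs2 k : k \in P -> log_ratio x y k <= 0 ->
    q * log_ratio x y k <= sigma k <= 1 * log_ratio x y k.
  move=> kP; exact: (slope k kP (rng k x xQ rx kP) (rng k y yQ ry kP)
    (Hp k kP) (Hq k kP)).2.
have HD k l : k \in P -> l \in P -> sigma k - sigma l <= E.
  move=> kP lP; rewrite -(@log_ratio_step _ _ P b bP x y k l) //; first exact: HE.
  - by rewrite (lt_le_trans r0) ?rx.
  - by rewrite (lt_le_trans r0) ?ry.
  - by rewrite (lt_le_trans r0) ?rx.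
  - by rewrite (lt_le_trans r0) ?ry.
have osc i j : i \in P -> j \in P ->
    log_ratio x y i - log_ratio x y j <= E + 2 * ((q - 1) * eta).
  move=> iP jP; have [[a aP ra] [c cP rc]] := pinch i iP.
  rewrite -[leLHS]mul1r.
  exact: (osc_expand ler01 q1 eta0 Hs1 Hs2 aP ra cP rc HD).
split=> // i iP; have [[a aP ra] [c cP rc]] := pinch i iP.
exact: (log_ratio_abs aP ra cP rc osc iP).
Qed.

(** [t] is chosen before [kappa] and [N], because the waiting time [N] of an orbit is found from
    [t], and [kappa] from [N]. *)
Lemma fiber_lipschitz S (r : R) i0 i1 : S \subset P -> 0 < r -> r <= 1 ->
  i0 \in S -> i1 \in S -> i0 != i1 ->
  exists2 t, 0 < t & forall (kappa : R) N, 0 < kappa -> (0 < N)%N ->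
  exists2 C, 0 <= C & forall x y, orthant_sphere x -> orthant_sphere y ->
    (forall n i, (n <= N)%N -> i \in P -> kappa <= iter n (amp_step b) x 0 i) ->
    (forall n i, (n <= N)%N -> i \in P -> kappa <= iter n (amp_step b) y 0 i) ->
    (forall n i, (N <= n)%N -> i \in S -> r <= iter n (amp_step b) x 0 i) ->
    (forall n i, (N <= n)%N -> i \in S -> r <= iter n (amp_step b) y 0 i) ->
    (forall n j, (N <= n)%N -> j \notin S -> iter n (amp_step b) x 0 j <= t) ->
    (forall n j, (N <= n)%N -> j \notin S -> iter n (amp_step b) y 0 j <= t) ->
    forall D, 0 <= D ->
    (forall j, j \notin P -> `|x 0 j - y 0 j| <= D) ->
    (forall j, j \in P :\: S ->
      `|iter N (amp_step b) x 0 j - iter N (amp_step b) y 0 j| <= D) ->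
    enorm (x - y) <= C * D.
Proof.
move=> SP r0 r1 i0S i1S i01.
have SiP i : i \in S -> i \in P by exact: (fintype.subsetP SP).
have [t t0 graph] := cone_graph SP r0 r1 i0S i1S i01.
exists t => // kappa N k0 N0.
have [q' q'0 Hq'] := amp_uniform_le bP k0.
pose q := q' + 1.
have Hq i : i \in P -> forall v u, kappa <= v -> v <= u -> u <= 1 ->
    ln (b i u) - ln (b i v) <= q * (ln u - ln v).
  move=> iP v u rv vu us; apply: le_trans (Hq' i iP v u rv vu us) _.
  rewrite ler_wpM2r //; last by rewrite /q; lra.
  by rewrite subr_ge0 ler_ln // posrE (lt_le_trans k0) // (le_trans rv).
have q1 : 1 <= q by rewrite /q; lra.
(* [M * D] bounds the log-ratios at time [N]: oscillation plus norm discrepancy over [S], and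
   [D / kappa] on the rest of [P]. [M'] adds the losses of the step from time 1 back to time 0, and
   a final 1 for the coordinates off [P]. *)
pose M := 1 + d%:R * (2 * 1 * 1) / r ^+ 2 + kappa^-1.
pose M' := 2 * M + 2 * ((q - 1) * (d%:R * (2 * 1 * 1) / kappa ^+ 2))
  + d%:R * (2 * 1 * 1) / kappa ^+ 2 + 1.
have dr0 : 0 <= d%:R :> R by rewrite ler0n.
have w0 (s : R) : 0 < s -> 0 <= d%:R * (2 * 1 * 1) / s ^+ 2.
  by move=> s0; apply: divr_ge0; [rewrite !mulr_ge0 | rewrite exprn_ge0 // ltW].
have M0 : 0 <= M by rewrite !addr_ge0 ?w0 // invr_ge0 ltW.
have q10 : 0 <= (q - 1) * (d%:R * (2 * 1 * 1) / kappa ^+ 2).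
  by rewrite mulr_ge0 ?w0 // subr_ge0.
have M'0 : 0 <= M' by rewrite /M'; have := w0 _ k0; lra.
exists (d%:R * M'); first by rewrite mulr_ge0.
move=> x y xQ yQ kx ky rx ry xt yt D D0 offP offS.
pose X n := iter n (amp_step b) x; pose Y n := iter n (amp_step b) y.
have XQ n : orthant_sphere (X n) := orthant_sphere_iter bP bN n xQ.
have YQ n : orthant_sphere (Y n) := orthant_sphere_iter bP bN n yQ.
have i0P := SiP _ i0S.
have offX n j : j \notin P -> X n.+1 0 j = 0.
  move=> jP; apply: (amp_step_off bP bN (XQ n) i0P _ jP).
  by apply: (amp_iter_gt0 bP bN _ xQ i0P); apply: lt_le_trans k0 (kx 0 i0 _ i0P).
have offY n j : j \notin P -> Y n.+1 0 j = 0.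
  move=> jP; apply: (amp_step_off bP bN (YQ n) i0P _ jP).
  by apply: (amp_iter_gt0 bP bN _ yQ i0P); apply: lt_le_trans k0 (ky 0 i0 _ i0P).
have offN j : j \notin S -> `|X N 0 j - Y N 0 j| <= D.
  move=> jS; have [jP|jP] := boolP (j \in P).
    by apply: offS; rewrite inE jS.
  by rewrite -(prednK N0) offX // offY // subrr normr0.
have oscS : forall i j, i \in S -> j \in S ->
    log_ratio (X N) (Y N) i - log_ratio (X N) (Y N) j <= D.
  apply: (graph (X N) (Y N)) => // [n i iS|n i iS|n j jS|n j jS].
  - by rewrite /X -iterD; apply: rx => //; exact: leq_addl.
  - by rewrite /Y -iterD; apply: ry => //; exact: leq_addl.
  - by rewrite /X -iterD; apply: xt => //; exact: leq_addl.
  - by rewrite /Y -iterD; apply: yt => //; exact: leq_addl.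
have DD0 : 0 <= d%:R * (2 * 1 * D) by rewrite !mulr_ge0.
have le1 (z : 'rV[R]_d) j : orthant_sphere z -> z 0 j <= 1.
  exact: orthant_sphere_le1.
have absN i : i \in P -> `|log_ratio (X N) (Y N) i| <= M * D.
  move=> iP; have [iS|iS] := boolP (i \in S).
    have rxN k : k \in S -> r <= X N 0 k by exact: rx.
    have ryN k : k \in S -> r <= Y N 0 k by exact: ry.
    have [[a aS ra] [c cS rc]] := log_ratio_pinch r0 DD0 i0S rxN ryN
      (sum_sqr_diff (XQ N) (YQ N) ler01 D0 (fun j _ => le1 _ j (XQ N))
        (fun j _ => le1 _ j (YQ N)) offN).
    apply: le_trans (log_ratio_abs aS ra cS rc oscS iS) _.
    have : 0 <= kappa^-1 * D by rewrite mulr_ge0 // invr_ge0 ltW.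
    have -> : d%:R * (2 * 1 * D) / r ^+ 2 = d%:R * (2 * 1 * 1) / r ^+ 2 * D by ring.
    by rewrite /M !mulrDl mul1r; lra.
  apply: le_trans (ln_dist_le k0 (kx N i (leqnn N) iP) (ky N i (leqnn N) iP)) _.
  rewrite mulrC; apply: (@le_trans _ _ (kappa^-1 * D)).
    by apply: ler_wpM2l; [rewrite invr_ge0 ltW | exact: offN].
  have := w0 _ r0; move/(mulr_ge0)/(_ D0).
  by rewrite /M !mulrDl mul1r; lra.
(* From time [N] down to time 1 both orbits vanish off [P], so the pullback has [D = 0] there and
   the constant does not grow with [N]. *)
have pull n : (n < N)%N -> forall i j, i \in P -> j \in P ->
    log_ratio (X (N - n)%N) (Y (N - n)%N) i - log_ratio (X (N - n)%N) (Y (N - n)%N) j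
      <= 2 * M * D.
  elim: n => [_ i j iP jP|n IH nN].
    rewrite subn0; have := absN i iP; have := absN j jP.
    by rewrite !ler_norml => /andP[h1 h2] /andP[h3 h4]; lra.
  have [l lE] : exists l, (N - n.+1)%N = l.+1.
    by exists (N - n.+1).-1; rewrite prednK // subn_gt0.
  have nl : (N - n)%N = l.+2 by rewrite -lE subnSK // ltnW.
  have lN : (l.+1 <= N)%N by rewrite -lE leq_subr.
  have := IH (ltnW nN); rewrite nl lE => HE.
  have := @log_ratio_pullback (X l.+1) (Y l.+1) kappa q 0 0 (2 * M * D) k0 q1
    (lexx 0) (lexx 0) Hq (XQ _) (YQ _) (fun i => kx _ i lN) (fun i => ky _ i lN).
  have z1 j : j \notin P -> X l.+1 0 j <= 0 by move=> jP; rewrite offX.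
  have z2 j : j \notin P -> Y l.+1 0 j <= 0 by move=> jP; rewrite offY.
  have z3 j : j \notin P -> `|X l.+1 0 j - Y l.+1 0 j| <= 0.
    by move=> jP; rewrite offX // offY // subrr normr0.
  move=> /(_ z1 z2 z3 HE)[+ _] i j iP jP => /(_ i j iP jP).
  by rewrite !(mulr0, mul0r) addr0.
have HE : forall i j, i \in P -> j \in P ->
    log_ratio (amp_step b x) (amp_step b y) i -
    log_ratio (amp_step b x) (amp_step b y) j <= 2 * M * D.
  have nN : (N.-1 < N)%N by rewrite prednK.
  have := pull N.-1 nN; have -> : (N - N.-1)%N = 1%N by rewrite -{1}(prednK N0) subSnn.
  by [].
have [_ abs0] := @log_ratio_pullback x y kappa q 1 D (2 * M * D) k0 q1 ler01 D0 Hq xQ yQ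
  (fun i => kx 0 i isT) (fun i => ky 0 i isT) (fun j _ => le1 _ j xQ)
  (fun j _ => le1 _ j yQ) offP HE.
apply: le_trans (enorm_le_sum _) _; rewrite -mulrA.
apply: sum_le_card => [|i _]; first by rewrite mulr_ge0.
have wk := mulr_ge0 (w0 _ k0) D0.
have qk := mulr_ge0 q10 D0; have MD := mulr_ge0 M0 D0.
have M'E : M' * D = 2 * (M * D) +
    2 * ((q - 1) * (d%:R * (2 * 1 * 1) / kappa ^+ 2) * D) +
    d%:R * (2 * 1 * 1) / kappa ^+ 2 * D + D by rewrite /M'; ring.
rewrite !mxE M'E; have [iP|iP] := boolP (i \in P); last first.
  by apply: le_trans (offP i iP) _; lra.
have xk := kx 0 i isT iP; have yk := ky 0 i isT iP.
apply: le_trans (dist_le_ln _ _) _.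
- by rewrite (lt_le_trans k0 xk) le1.
- by rewrite (lt_le_trans k0 yk) le1.
apply: le_trans (abs0 i iP) _.
have -> : d%:R * (2 * 1 * D) / kappa ^+ 2 = d%:R * (2 * 1 * 1) / kappa ^+ 2 * D by ring.
by rewrite mulrA; lra.
Qed.

End Fiber.

(** * The exceptional set *)

Section NullSets.
Context {R : realType} {d : nat}.
Variable e : orthobasis R d.

Definition sign_pattern (u : sphere R d) : {ffun 'I_d -> bool} :=
  [ffun j => dot u (e j) < 0].

(** On each of the finitely many sign patterns [absc] is an isometry, so covers can be built in
    absolute coordinates. *)
Lemma mdist_same_sign (u v : sphere R d) : sign_pattern u = sign_pattern v ->
  mdist u v = enorm (absc e u - absc e v).
Proof.
move=> /ffunP uv; rewrite /mdist /= /sphere_dist; congr Num.sqrt.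
rewrite (parseval e); apply: eq_bigr => j _; have := uv j; rewrite !ffunE.
rewrite dotDl -scaleN1r dotZl mulN1r !mxE.
have [u0|u0] := ltP (dot u (e j)) 0; have [v0|v0] := ltP (dot v (e j)) 0 => // _.
  by rewrite !ltr0_norm //; ring.
by rewrite !ger0_norm.
Qed.

Lemma card_compl_lt (S : {set 'I_d}) i j : i \in S -> j \in S -> i != j ->
  (#|{: {k : 'I_d | k \notin S}}| < d.-1)%N.
Proof.
move=> iS jS ij; have S2 : (1 < #|S|)%N.
  by rewrite (cardsD1 i) iS (cardsD1 j) !inE eq_sym ij jS.
have -> : #|{: {k : 'I_d | k \notin S}}| = #|~: S|.
  by rewrite card_sig; apply: eq_card => k; rewrite !inE.
have := cardsC S; rewrite card_ord => E.
have d1 : (1 < d)%N by rewrite -E (leq_trans S2) // leq_addr.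
by rewrite ltn_predRL -[X in (_ < X)%N]E -[X in (X < _)%N]add1n ltn_add2r.
Qed.

(** Some coordinate [l] is at least [1 / d] in absolute value. The unit norm makes it a Lipschitz
    function of the others, with constant [d^2]; as coordinate [i] is 0, only [d - 2] parameters
    remain. *)
Lemma hnull_hyperplane (i : 'I_d) : (1 < d)%N ->
  hnull d.-1 [set u : sphere R d | dot u (e i) = 0].
Proof.
move=> d1; have d0 : (0 < d)%N by exact: ltnW.
have s0 : (0 < d.-1)%N by rewrite -ltnS prednK.
have dr0 : 0 < d%:R :> R by rewrite ltr0n.
pose A (a : 'I_d * {ffun 'I_d -> bool}) := [set u : sphere R d |
  [/\ dot u (e i) = 0, d%:R^-1 <= absc e u 0 a.1 & sign_pattern u = a.2]].
apply: (@hnullS _ _ _ _ (\bigcup_a A a)).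
  move=> u /= ui; have uQ := orthant_sphere_absc e u.
  have [l _ lu] := @exists_large R d [set: 'I_d]%SET (absc e u) d0 uQ
    (fun j h => False_ind _ (negP h (finset.in_setT j))).
  by exists (l, sign_pattern u).
apply: hnull_countable_bigcup => // -[l sg].
(* For [l = i] the piece is empty: its coordinate is both 0 and at least [1 / d]. *)
have [-> {l}|li] := eqVneq l i.
  move=> eps e0; exists (fun=> set0); split.
    move=> u [/= ui]; rewrite mxE ui normr0 => h.
    by exfalso; move: h; rewrite leNgt invr_gt0 dr0.
  rewrite eseries0 ?lee_fin ?ltW // => k _ _; rewrite diam_set0.
  by rewrite -(prednK s0) expeS mul0e.
pose S : {set 'I_d} := [set i; l]%SET.
pose f (u : sphere R d) (j : {k : 'I_d | k \notin S}) := absc e u 0 (val j).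
apply: (@hnull_param _ _ _ _ _ f (d%:R * (1 + d%:R * d%:R))).
- by apply: (@card_compl_lt S i l); rewrite ?inE ?eqxx ?orbT // eq_sym.
- by rewrite mulr_ge0 // addr_ge0 // mulr_ge0.
- move=> u j _; have uQ := orthant_sphere_absc e u.
  by rewrite uQ.1 orthant_sphere_le1.
move=> u v t [/= ui ul us] [/= vi vl vs] t0 uv.
have uQ := orthant_sphere_absc e u; have vQ := orthant_sphere_absc e v.
rewrite mdist_same_sign ?us ?vs //.
apply: le_trans (enorm_le_sum _) _; rewrite -mulrA.
have ct : t <= (1 + d%:R * d%:R) * t by rewrite ler_peMl // lerDl mulr_ge0.
have off j : j != l -> `|absc e u 0 j - absc e v 0 j| <= t.
  move=> jl; have [->|ji] := eqVneq j i.
    by rewrite !mxE ui vi normr0 subrr normr0.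
  have jS : j \notin S by rewrite !inE negb_or ji.
  exact: (uv (exist _ j jS)).
apply: sum_le_card => [|j _]; first by rewrite (le_trans t0).
rewrite !mxE; have := off j; have [->|jl] := eqVneq j l; last first.
  by rewrite !mxE => /(_ isT) h; exact: le_trans ct.
move=> _.
have := @sum_sqr_diff R d [set l]%SET (absc e u) (absc e v) 1 t uQ vQ ler01 t0
  (fun j _ => orthant_sphere_le1 j uQ) (fun j _ => orthant_sphere_le1 j vQ).
have off' j' : j' \notin [set l]%SET -> `|absc e u 0 j' - absc e v 0 j'| <= t.
  by rewrite inE; exact: off.
move=> /(_ off'); rewrite big_set1 subr_sqr normrM.
have sl : 2 * d%:R^-1 <= `|absc e u 0 l + absc e v 0 l|.
  by apply: le_trans (ler_norm _); move: ul vl; lra.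
move=> h; have : `|absc e u 0 l - absc e v 0 l| * (2 * d%:R^-1) <= d%:R * (2 * 1 * t).
  by apply: le_trans h; rewrite ler_wpM2l.
rewrite -ler_pdivlMr; last by rewrite mulr_gt0 // invr_gt0.
rewrite !mxE => /le_trans; apply.
have -> : d%:R * (2 * 1 * t) / (2 * d%:R^-1) = d%:R * d%:R * t.
  by field; exact: lt0r_neq0.
by rewrite mulrDl mul1r lerDr.
Qed.

End NullSets.

Section Exceptional.
Context {R : realType} {d : nat}.
Variables (e : orthobasis R d) (F : 'rV[R]_d -> R).
Variables (P : {set 'I_d}) (b : 'I_d -> R -> R).
Hypothesis bP : forall i, i \in P -> amplifier (b i).
Hypothesis bN : forall i x, i \notin P -> b i x = 0.
Hypothesis stepE : forall u : sphere R d,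
  absc e (gradient_iter F u) = amp_step b (absc e u).
Hypothesis d1 : (1 < d)%N.

Let X u n := iter n (amp_step b) (absc e u).

(** The late time is [N.+1], so that at least one step has been made and the coordinates off [P]
    have vanished. *)
Lemma hnull_slow (S : {set 'I_d}) (r : R) i0 i1 : S \subset P -> 0 < r -> r <= 1 ->
  i0 \in S -> i1 \in S -> i0 != i1 ->
  exists2 t, 0 < t & forall N k (sg : {ffun 'I_d -> bool}),
    hnull d.-1 [set u : sphere R d | [/\ sign_pattern e u = sg,
      forall n i, (n <= N.+1)%N -> i \in P -> k.+1%:R^-1 <= X u n 0 i,
      forall n i, (N < n)%N -> i \in S -> r <= X u n 0 i &
      forall n j, (N < n)%N -> j \notin S -> X u n 0 j <= t]].
Proof.
move=> SP r0 r1 i0S i1S i01.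
have [t t0 Ht] := fiber_lipschitz bP bN SP r0 r1 i0S i1S i01.
exists t => // N k sg.
have k0 : 0 < k.+1%:R^-1 :> R by rewrite invr_gt0 ltr0n.
have [C C0 HC] := Ht _ N.+1 k0 isT.
pose f (u : sphere R d) (j : {j : 'I_d | j \notin S}) : R :=
  if val j \in P then X u N.+1 0 (val j) else X u 0 0 (val j).
have XQ (u : sphere R d) n : orthant_sphere (X u n).
  exact: (orthant_sphere_iter bP bN n (orthant_sphere_absc e u)).
apply: (@hnull_param _ _ _ _ _ f C) => //.
- exact: (card_compl_lt i0S i1S i01).
- by move=> u j _; rewrite /f; case: ifP => _; rewrite (XQ _ _).1 orthant_sphere_le1.
move=> u v D [us uk ur ut] [vs vk vr vt] D0 uv.
rewrite (mdist_same_sign (e := e)) ?us ?vs //.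
apply: HC => //; try exact: orthant_sphere_absc.
- move=> j jP; have jS : j \notin S by apply: contra jP; exact: (fintype.subsetP SP).
  by have := uv (exist _ j jS); rewrite /f /= (negPf jP).
- move=> j; rewrite inE => /andP[jS jP].
  by have := uv (exist _ j jS); rewrite /f /= jP.
Qed.

Lemma hnull_exceptional : (exists i, i \in P) ->
  hnull d.-1 [set u : sphere R d | ~ exists2 i, i \in P &
    class_of_pt e (iter n (gradient_iter F) u) @[n --> \oo] -->
      class_of_pt e (basis_pt e i)].
Proof.
move=> [p0 p0P]; have d0 : (0 < d)%N by exact: ltnW.
have s0 : (0 < d.-1)%N by rewrite -ltnS prednK.
have [r' r'0 dich] := amp_dichotomy bP bN d0.
pose r := Num.min r' 1.
have r0 : 0 < r by rewrite lt_min r'0 ltr01.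
have r1 : r <= 1 by rewrite ge_min lexx orbT.
have rr' : r <= r' by rewrite ge_min lexx.
pose valid (a : {set 'I_d} * 'I_d * 'I_d) :=
  [/\ a.1.1 \subset P, a.1.2 \in a.1.1, a.2 \in a.1.1 & a.1.2 != a.2].
pose slow a t N k sg := [set u : sphere R d | valid a /\
  [/\ sign_pattern e u = sg,
      forall n i, (n <= N.+1)%N -> i \in P -> k.+1%:R^-1 <= X u n 0 i,
      forall n i, (N < n)%N -> i \in a.1.1 -> r <= X u n 0 i &
      forall n j, (N < n)%N -> j \notin a.1.1 -> X u n 0 j <= t]].
(* [t] is attached to the triple before any orbit is given. For an invalid triple the piece is empty
   and 1 is a dummy value. *)
have slow_null a : exists t, 0 < t /\ forall N k sg, hnull d.-1 (slow a t N k sg).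
  have [va|nva] := pselect (valid a).
    have [SP iS jS ij] := va.
    have [t t0 Ht] := hnull_slow SP r0 r1 iS jS ij.
    by exists t; split => // N k sg; apply: hnullS (Ht N k sg) => u [].
  exists 1; split => // N k sg eps e0; exists (fun=> set0); split.
    by move=> u [].
  rewrite eseries0 ?lee_fin ?ltW // => n _ _; rewrite diam_set0.
  by rewrite -(prednK s0) expeS mul0e.
have [t Ht] := choice slow_null.
pose I := ('I_d + ({set 'I_d} * 'I_d * 'I_d) * nat * nat * {ffun 'I_d -> bool})%type.
pose A (a : I) : set (sphere R d) := match a with
  | inl i => [set u : sphere R d | dot u (e i) = 0]
  | inr (s, N, k, sg) => slow s (t s) N k sg
  end.
apply: (@hnullS _ _ _ _ (\bigcup_a A a)); last first.
  apply: hnull_countable_bigcup => // -[i|[[[s N] k] sg]].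
    exact: hnull_hyperplane.
  exact: (Ht s).2.
move=> u /= nconv.
have XQ n : orthant_sphere (X u n).
  exact: (orthant_sphere_iter bP bN n (orthant_sphere_absc e u)).
have [[i ui]|nz] := pselect (exists i, dot u (e i) = 0); first by exists (inl i).
have Xpos n i : i \in P -> 0 < X u n 0 i.
  move=> iP; apply: (amp_iter_gt0 bP bN _ (orthant_sphere_absc e u) iP).
  by rewrite mxE normr_gt0; apply/eqP => ui; apply: nz; exists i.
have X1N j : j \notin P -> X u 1 0 j = 0.
  by move=> jP; apply: (amp_step_off bP bN (XQ 0) p0P _ jP); exact: (Xpos 0).
(* The dichotomy starts at time 1, when the coordinates off [P] are zero. *)
have [S [SP Slow Shigh]] := dich (X u 1) (XQ 1) (Xpos 1) X1N.
have XE n : iter n (amp_step b) (X u 1) = X u n.+1.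
  by rewrite /X -iterD addn1.
have X_N n j : j \notin P -> X u n.+1 0 j = 0.
  by move=> jP; apply: (amp_step_off bP bN (XQ n) p0P _ jP); exact: Xpos.
(* With [S] empty all coordinates would end up below [1 / (2 d)], although one of them is always at
   least [1 / d]. *)
have [i0 i0S] : exists i, i \in S.
  apply/existsP; apply: contrapT => /negP; rewrite negb_exists => /forallP nS.
  have dr0 : 0 < d%:R^-1 / 2 :> R by rewrite divr_gt0 // invr_gt0 ltr0n.
  have [n0 Hn] := Shigh _ dr0.
  have [j jP] := @exists_large R d P (X u n0.+1) d0 (XQ _) (X_N n0).
  have := Hn n0 (leqnn _) j (nS j); rewrite XE.
  by have : 0 < d%:R^-1 :> R by [rewrite invr_gt0 ltr0n]; lra.
have [i1 [i1S i01]] : exists i1, i1 \in S /\ i0 != i1.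
  apply: contrapT => H; apply: nconv; exists i0; first exact: (fintype.subsetP SP).
  apply: (cvg_vertex stepE d1) => s ss.
  have [n0 Hn] := Shigh s ss; exists n0.+1 => -[//|n] kn j ji.
  rewrite -/(X u n.+1) -XE; apply: Hn => //.
  by apply/negP => jS; apply: H; exists j; split => //; rewrite eq_sym.
pose a := (S, i0, i1).
have [N HN] := Shigh (t a) (Ht a).1.
(* The coordinates in [P] at times up to [N + 1] are finitely many positive numbers; [k] discretizes
   their lower bound. *)
have [c c0 Hc] : exists2 c : R, 0 < c & forall q : 'I_N.+2 * 'I_d, q.2 \in P ->
    c <= X u q.1 0 q.2.
  apply: fin_uniform_pos => [q c c' _ cc' H qP|[n i]]; first exact: le_trans (H qP).
  have [iP|iP] := boolP (i \in P); last by exists 1.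
  by exists (X u n 0 i) => //; exact: Xpos.
pose k := Num.truncn c^-1.
have kc : k.+1%:R^-1 <= c.
  have c'0 : 0 <= c^-1 by rewrite invr_ge0 ltW.
  have /andP[_ /ltW h] := Num.Theory.truncn_itv c'0.
  by rewrite -[leRHS]invrK lef_pV2 // posrE ?ltr0n // invr_gt0.
exists (inr (a, N, k, sign_pattern e u)) => //=; split => //; split => //.
- move=> n i nN iP; apply: le_trans kc _.
  have nN' : (n < N.+2)%N by [].
  exact: (Hc (Ordinal nN', i) iP).
- move=> [//|n] i nN iS; rewrite -XE; apply: le_trans rr' (ltW _); exact: Slow.
- by move=> [//|n] j nN jS; rewrite -XE; exact: HN.
Qed.

End Exceptional.

Theorem theorem2p7 (R : realType) (d m : nat) (hd : (2 <= d)%N)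
    (hm : (1 <= m)%N) (hmd : (m <= d)%N) (e : orthobasis R d)
    (g : 'I_m -> R -> R) (F : 'rV[R]_d -> R) (hF : odeco hmd e g F) :
  (forall i : 'I_m,
     attractor (gradient_iter_quot (e := e) F)
       (class_of_pt e (basis_pt e (widen_ord hmd i)))) /\
  (exists X : set (sphere R d),
     full_surface_measure X /\
     forall u0 : sphere R d, X u0 ->
       exists i : 'I_m,
         class_of_pt e (iter n (gradient_iter F) u0) @[n --> \oo]
           --> class_of_pt e (basis_pt e (widen_ord hmd i))).
Proof.
have [b [bP' bN' stepE]] := odeco_step hF.
pose P : {set 'I_d} := [set i : 'I_d | (i < m)%N]%SET.
have bP i : i \in P -> amplifier (b i) by rewrite inE; exact: bP'.
have bN i x : i \notin P -> b i x = 0 by rewrite inE -leqNgt; exact: bN'.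
have wP (i : 'I_m) : widen_ord hmd i \in P by rewrite inE /=.
split=> [i|]; first exact: (vertex_attractor bP bN stepE hd (wP i)).
exists [set u | exists2 i, i \in P &
  class_of_pt e (iter n (gradient_iter F) u) @[n --> \oo] -->
    class_of_pt e (basis_pt e i)]; split.
  rewrite /full_surface_measure; apply: hnull_measure.
    by rewrite -ltnS prednK // ltnW.
  apply: (hnull_exceptional bP bN stepE hd).
  by exists (widen_ord hmd (Ordinal hm)).
move=> u [i]; rewrite inE => im conv; exists (Ordinal im).
by have -> : widen_ord hmd (Ordinal im) = i by exact: val_inj.
Qed.
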